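(* Assume that for each $k\in[K]$ and $(i,i')\in\{(0,1),(1,0)\}$, $\int\log(f_i^k/f_{i'}^k)f_i^k\,d\mu^k>0$ and $\int[\log(f_i^k/f_{i'}^k)]^2f_i^k\,d\mu^k<\infty$. Let $\alpha,\beta\in(0,1)$ satisfy $C^{-1}\alpha\le\beta\le C\alpha$ for some absolute constant $C>0$, and let $a_{\alpha,\beta}=|\log\beta|+\log K$ and $b_{\alpha,\beta}=|\log\alpha|+\log K$. Then the Intersection rule $\{\delta_I(a_{\alpha,\beta},b_{\alpha,\beta})\}$ is second-order asymptotically optimal in $\{\Delta^{\mathrm{fdr}}(\alpha,\beta)\}$ as $\alpha,\beta\to0$ (under the constraint $C^{-1}\alpha\le\beta\le C\alpha$), that is, for each $A\subset[K]$, $$\limsup_{\alpha,\beta\to0}\Bigl(\mathbb E_A[T_I(a_{\alpha,\beta},b_{\alpha,\beta})]-T_A^{\min}\bigl(\Delta^{\mathrm{fdr}}(\alpha,\beta)\bigr)\Bigr)<\infty.$$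
   Context: $K\ge2$, $[K]=\{1,\dots,K\}$. For each $k\in[K]$, $\mu^k$ is a $\sigma$-finite measure on a measurable space $\mathcal X^k$ and $f_0^k,f_1^k$ are probability densities with respect to $\mu^k$. One observes $K$ independent streams $\{\mathbf X_t^k:t\ge1\}$, each i.i.d. For $A\subset[K]$, $\mathbb P_A$ (expectation $\mathbb E_A$) is the law under which the streams are independent and stream $k$ is i.i.d. with density $f_1^k$ if $k\in A$ and $f_0^k$ if $k\notin A$. $\mathcal F_t$ is the $\sigma$-field generated by all observations from all streams up to time $t$. Here $\mathcal A=2^{[K]}$. A sequential procedure is a pair $(T,D)$ with $T$ an $\{\mathcal F_t\}_{t\ge1}$-stopping time and $D$ an $\mathcal F_T$-measurable decision with values in $\mathcal A$; $\Delta$ is the class of all such procedures. For $\Delta'\subset\Delta$, $T_A^{\min}(\Delta')=\inf_{(T,D)\in\Delta'}\mathbb E_A[T]$. The class controlling the false discovery and false non-discovery rates is $$\Delta^{\mathrm{fdr}}(\alpha,\beta)=\Bigl\{(T,D)\in\Delta:\max_{A\subset[K]}\mathbb E_A\Bigl[\tfrac{|D\setminus A|}{\max\{|D|,1\}}\Bigr]\le\alpha,\ \max_{A\subset[K]}\mathbb E_A\Bigl[\tfrac{|A\setminus D|}{\max\{|D^c|,1\}}\Bigr]\le\beta\Bigr\}.$$ Log-likelihood ratios: $\lambda_t^k=\sum_{s=1}^t\log\frac{f_1^k(\mathbf X_s^k)}{f_0^k(\mathbf X_s^k)}$. The Intersection rule $\delta_I(a,b)=(T_I(a,b),D_I(a,b))$,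 $a,b>0$, is $T_I(a,b)=\min\{t\ge1:\lambda_t^k\notin(-a,b)\text{ for all }k\in[K]\}$, $D_I(a,b)=\{k\in[K]:\lambda_{T_I(a,b)}^k>0\}$. It is known from earlier work that $\delta_I(a_{\alpha,\beta},b_{\alpha,\beta})\in\Delta^{\mathrm{fdr}}(\alpha,\beta)$. *)

(* Defs.v *)
From HB Require Import structures.
From mathcomp Require Export all_boot all_order all_algebra finmap.
From mathcomp Require Export all_classical all_reals all_analysis.
Export Order.TTheory GRing.Theory Num.Theory.
Export numFieldNormedType.Exports.

Set Implicit Arguments.
Unset Strict Implicit.
Unset Printing Implicit Defensive.

Local Open Scope classical_set_scope.
Local Open Scope ring_scope.
Local Open Scope ereal_scope.

Definition is_density (R : realType) (d : measure_display)
    (X : measurableType d) (mu : {measure set X -> \bar R}) (g : X -> R) : Prop :=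
  [/\ measurable_fun [set: X] g, (forall x, (0 <= g x)%R)
    & \int[mu]_x (g x)%:E = 1].

(* Extended-real valued: by the conventions of [inve] and [lne] the ratio is
   +oo where f = 0 < g and -oo where g = 0. *)
Definition log_ratio (R : realType) (X : Type) (g f : X -> R) (x : X) : \bar R :=
  lne ((g x)%:E / (f x)%:E).

Definition mutually_independent (R : realType) (d : measure_display)
    (Omega : measurableType d) (P : probability Omega R)
    (I : choiceType) (dY : I -> measure_display)
    (Y : forall i, measurableType (dY i)) (Z : forall i, Omega -> Y i) : Prop :=
  forall (J : {fset I}) (B : forall i, set (Y i)),
    (forall i, i \in J -> measurable (B i)) ->
    P (\bigcap_(i in [set` J]) (Z i @^-1` B i)) =
    \prod_(i <- J) P (Z i @^-1` B i).

Section streams.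
Context {R : realType} {K : nat} {dX : 'I_K -> measure_display}
  {X : forall k, measurableType (dX k)}
  {d : measure_display} {Omega : measurableType d}.
(* Time is shifted: [obs s k] is the observation of stream k made at time
   s + 1, so that the observations made up to time t are those with s < t. *)
Variable obs : nat -> forall k : 'I_K, Omega -> X k.

Definition is_law (mu : forall k, {measure set X k -> \bar R})
    (g : forall k, X k -> R) (P : probability Omega R) : Prop :=
  (forall s k (B : set (X k)), measurable B ->
     P (obs s k @^-1` B) = \int[mu k]_(x in B) (g k x)%:E) /\
  mutually_independent P (fun i : nat * 'I_K => obs i.1 i.2).

Definition filtration (t : nat) : set (set Omega) :=
  <<s [set E | exists s (k : 'I_K) (B : set (X k)),
         [/\ (s < t)%N, measurable B & E = obs s k @^-1` B]] >>.

Definition filtration_oo : set (set Omega) :=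
  <<s \bigcup_t filtration t >>.

(* Times take their values in {0, 1, ...} + {oo}, with None standing for oo. *)
Definition time_le (T : Omega -> option nat) (t : nat) : set Omega :=
  [set w | oapp (fun n => (n <= t)%N) false (T w)].

Definition etime (T : Omega -> option nat) (w : Omega) : \bar R :=
  oapp (fun n => n%:R%:E) +oo (T w).

Definition stopping_time (T : Omega -> option nat) : Prop :=
  (forall w, T w != Some 0%N) /\
  forall t, (1 <= t)%N -> filtration t (time_le T t).

Definition stopped_sigma (T : Omega -> option nat) : set (set Omega) :=
  [set E | filtration_oo E /\
           forall t, (1 <= t)%N -> filtration t (E `&` time_le T t)].

Definition procedure := ((Omega -> option nat) * (Omega -> {set 'I_K}))%type.

Definition sequential_procedures : set procedure :=
  [set delta | stopping_time delta.1 /\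
     forall B : {set 'I_K}, stopped_sigma delta.1 [set w | delta.2 w = B]].

Definition false_discovery_prop (A D : {set 'I_K}) : R :=
  (#|(D :\: A)%SET|%:R / (maxn #|D| 1)%:R)%R.

Definition false_nondiscovery_prop (A D : {set 'I_K}) : R :=
  (#|(A :\: D)%SET|%:R / (maxn #|(~: D)%SET| 1)%:R)%R.

Variable P : {set 'I_K} -> probability Omega R.

Definition fdr_class (alpha beta : R) : set procedure :=
  [set delta | [/\ sequential_procedures delta,
     \big[maxe/-oo]_(A : {set 'I_K})
        'E_(P A)[fun w => false_discovery_prop A (delta.2 w)] <= alpha%:E
   & \big[maxe/-oo]_(A : {set 'I_K})
        'E_(P A)[fun w => false_nondiscovery_prop A (delta.2 w)] <= beta%:E]].

Definition expected_time (A : {set 'I_K}) (T : Omega -> option nat) : \bar R :=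
  \int[P A]_w etime T w.

Definition min_expected_time (A : {set 'I_K}) (S : set procedure) : \bar R :=
  ereal_inf [set expected_time A delta.1 | delta in S].

(* The dual subtraction sets +oo - +oo = +oo, whereas the default one gives -oo;
   an upper bound on this difference thus cannot hold for the mere reason that
   both terms are infinite. *)
Definition excess_time (A : {set 'I_K}) (delta : procedure) (S : set procedure)
    : \bar R :=
  (expected_time A delta.1 - min_expected_time A S)%dE.

Definition log_lik_ratio (f : forall k, bool -> X k -> R)
    (t : nat) (k : 'I_K) (w : Omega) : \bar R :=
  \sum_(s < t) log_ratio (f k true) (f k false) (obs s k w).

Definition first_time (Q : pred nat) : option nat :=
  if pselect (exists t, Q t) is left exQ then Some (ex_minn exQ) else None.

Definition intersection_time (f : forall k, bool -> X k -> R)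
    (a b : R) (w : Omega) : option nat :=
  first_time (fun t => (1 <= t)%N &&
    [forall k, ~~ ((- a)%:E < log_lik_ratio f t k w < b%:E)]).

(* The decision on the event that the rule never stops is arbitrary. *)
Definition intersection_decision (f : forall k, bool -> X k -> R)
    (a b : R) (w : Omega) : {set 'I_K} :=
  if intersection_time f a b w is Some t
  then [set k | 0 < log_lik_ratio f t k w]%SET else finset.set0.

Definition intersection_rule (f : forall k, bool -> X k -> R)
    (a b : R) : procedure :=
  (intersection_time f a b, intersection_decision f a b).

End streams.

(* Main.v *)
From HB Require Import structures.
Require Import Defs.
From mathcomp Require Import measurable_realfun.
From mathcomp Require Import ring lra.

Set Implicit Arguments.
Unset Strict Implicit.
Unset Printing Implicit Defensive.

Import HBNNSimple.

Local Open Scope classical_set_scope.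
Local Open Scope ring_scope.
Local Open Scope ereal_scope.


(** Write B for the set A with stream k flipped, and L for the likelihood
    ratio dP_B/dP_A of the observations made so far. The Intersection rule
    with thresholds a, b <= h is still running at time t only if, for some k,
    the log-likelihood ratio of stream k towards the truth is below h, that
    is, only if exp (h/2) sqrt L_t >= 1 (sqrt_flip_ratio_exit). Two facts
    about L then compare the rule with an arbitrary procedure (T, D).

    After time T the square roots contract. Given the past, one more
    observation multiplies the mean of sqrt L under P_A by the Hellinger
    affinity rho < 1 of the two laws of stream k (integral_sqrt_lik_ratio,
    flip_affinity). The expected number of times after T at which stream k
    keeps the rule running is therefore at most E_A[exp (h/2) sqrt L_T] / (1 -
    rho).

    At time T that quantity is bounded. A set E in the past of time n
    satisfies E_A[L_n; E] <= P_B(E) (change_of_measure). Where D = A, the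
    inequality exp (h/2) sqrt L <= (1 + exp h L)/2 yields the bound (1 + exp h
    P_B(D = A))/2, and D = A is an error under P_B. Where D <> A, the
    inequality exp (h/2) sqrt L <= (exp h + L)/2 yields (exp h P_A(D <> A) +
    1)/2, and D <> A is an error under P_A. Hence E_A[T_I] <= E_A[T] + sum_k
    (1 + exp h eps)/(1 - rho_k) as soon as all error probabilities are at most
    eps (expected_intersection_time_error).

    Finally, a wrong decision makes one of the two false proportions at least
    1/K, so that eps = K (alpha + beta) on the class under study
    (fdr_wrong_decision), while exp h is K / min(alpha, beta). When alpha and
    beta are comparable, exp h eps stays bounded (expR_max_threshold), and the
    excess is bounded uniformly in alpha and beta, not merely in the limit. *)

(** * Lebesgue integrals: non-measurable minorants and image densities *)

(** The integral of a nonnegative function is a supremum over the simple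
    functions below it, hence monotone even when the smaller function is not
    measurable. This dispenses with measurability of the stopping time of the
    Intersection rule and of the log-likelihood ratio. *)
Lemma ge0_ae_le_integral_lower d (T : measurableType d) (R : realType)
    (mu : {measure set T -> \bar R}) (f g : T -> \bar R) :
  (forall x, 0 <= f x) -> (forall x, 0 <= g x) -> measurable_fun setT g ->
  {ae mu, forall x, f x <= g x} ->
  \int[mu]_x f x <= \int[mu]_x g x.
Proof.
move=> f0 g0 mg fg; rewrite ge0_integralTE//.
apply: ge_ereal_sup => _ [h hf <-].
rewrite -integralT_nnsfun; apply: ae_ge0_le_integral => //.
- by move=> x _; rewrite lee_fin.
- exact/measurable_EFinP/measurable_funP.
- by move: fg; apply: filterS => x fgx _; exact: le_trans (hf x) fgx.
Qed.

Lemma indic_preimage (R : realType) (T U : Type) (Z : T -> U) (B : set U) w :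
  \1_(Z @^-1` B) w = \1_B (Z w) :> R.
Proof.
by rewrite !indicE; congr (_%:R); congr nat_of_bool;
  apply/idP/idP; rewrite !inE.
Qed.

Section image_density.
Context d (T : measurableType d) (R : realType) d' (Y : measurableType d').
Variables (mu : {measure set T -> \bar R}) (g : T -> \bar R) (Z : T -> Y).
Hypotheses (mg : measurable_fun setT g) (g0 : forall x, 0 <= g x).
Hypothesis mZ : measurable_fun setT Z.

(** The image under [Z] of the measure with density [g]: [Z := idfun] gives a
    density, and [g := cst 1] an image measure. The proofs are arguments so that
    the measure structure can be inferred from the term. *)
Definition image_density & measurable_fun setT g & (forall x, 0 <= g x)
  & measurable_fun setT Z : set Y -> \bar R :=
  fun B => \int[mu]_(x in Z @^-1` B) g x.

Let nu := image_density mg g0 mZ.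

Let mpre B : measurable B -> measurable (Z @^-1` B).
Proof. by move=> mB; rewrite -[_ @^-1` _]setTI; exact: mZ. Qed.

Let nu0 : nu set0 = 0.
Proof. by rewrite /nu /image_density preimage_set0 integral_set0. Qed.

Let nu_ge0 B : 0 <= nu B. Proof. by apply: integral_ge0 => x _; exact: g0. Qed.

Let nu_sigma_additive : semi_sigma_additive nu.
Proof.
move=> F mF tF mUF; rewrite /nu /image_density preimage_bigcup.
rewrite ge0_integral_bigcup//.
- by apply: is_cvg_nneseries => n _ _; exact: nu_ge0.
- by move=> n; exact: mpre.
- exact: measurable_funTS.
- apply/trivIsetP => /= i j _ _ ij; rewrite -preimage_setI.
  by move/trivIsetP : tF => /(_ _ _ _ _ ij) ->//; rewrite preimage_set0.
Qed.

HB.instance Definition _ := isMeasure.Build _ _ _ (image_density mg g0 mZ)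
  nu0 nu_ge0 nu_sigma_additive.

Lemma ge0_integral_image_density (f : Y -> \bar R) :
  measurable_fun setT f -> (forall x, 0 <= f x) ->
  \int[image_density mg g0 mZ]_x f x = \int[mu]_x (f (Z x) * g x).
Proof.
move=> mf f0; pose f_ := nnsfun_approx measurableT mf.
have fE x : f x = limn (fun n => (f_ n x)%:E).
  by apply/esym/cvg_lim => //; apply: cvg_nnsfun_approx.
have mf_ n : measurable_fun setT (EFin \o f_ n).
  exact/measurable_EFinP/measurable_funP.
have nd x : nondecreasing_seq (fun n => (f_ n x)%:E).
  by move=> m n mn; rewrite lee_fin; exact/lefP/nd_nnsfun_approx.
transitivity (limn (fun n => \int[nu]_x (f_ n x)%:E)).
  rewrite -monotone_convergence//.
  - by apply: eq_integral => x _.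
  - by move=> n x _; rewrite lee_fin.
transitivity (limn (fun n => \int[mu]_x ((f_ n (Z x))%:E * g x))); last first.
  rewrite -monotone_convergence//.
  - apply: eq_integral => x _; apply/cvg_lim => //.
    have [fx|fx] := eqVneq (f (Z x)) 0.
      have f_x n : (f_ n (Z x))%:E = 0.
        apply/eqP; rewrite eq_le; apply/andP; split; last by rewrite lee_fin.
        rewrite -fx fE; apply: lime_ge; last first.
          by exists n => // m /= nm; exact: nd.
        by apply: ereal_nondecreasing_is_cvgn; exact: nd.
      by under eq_fun do rewrite f_x mul0e; rewrite fx mul0e; exact: cvg_cst.
    have [gx|gx] := eqVneq (g x) 0.
      by rewrite gx mule0; under eq_fun do rewrite mule0; exact: cvg_cst.
    apply: cvgeM; [by apply: neq0_mule_def; rewrite mule_neq0| |exact: cvg_cst].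
    exact: cvg_nnsfun_approx.
  - move=> k; apply: emeasurable_funM => //.
    exact: (measurableT_comp (mf_ k) mZ).
  - by move=> k x _; rewrite mule_ge0// lee_fin.
  - by move=> x _ m n mn; rewrite lee_wpmul2r// nd.
congr (limn _); apply/funext => n.
have mf1 r : measurable_fun setT (fun x => (\1_(f_ n @^-1` [set r]) (Z x))%:E).
  by apply/measurable_EFinP; apply: measurableT_comp.
transitivity (\sum_(r \in range (f_ n))
    r%:E * \int[mu]_(x in Z @^-1` (f_ n @^-1` [set r])) g x).
  rewrite integralT_nnsfun sintegralE; apply: eq_fsbigr => r _.
  by [].
transitivity (\sum_(r \in range (f_ n))
    \int[mu]_x (r%:E * (\1_(f_ n @^-1` [set r]) (Z x))%:E * g x)).
  apply: eq_fsbigr => r; rewrite inE => -[x _ rE].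
  under [RHS]eq_integral do rewrite -muleA.
  rewrite ge0_integralZl//; last 3 first.
  - exact: emeasurable_funM.
  - by move=> y _; rewrite mule_ge0// lee_fin.
  - by rewrite -rE lee_fin.
  congr (_ * _); rewrite integral_mkcond; apply: eq_integral => y _.
  by rewrite patchE -indic_preimage indicE; case: ifPn; rewrite ?mul1e ?mul0e.
rewrite -ge0_integral_fsum//.
- apply: eq_integral => x _; rewrite -ge0_mule_fsuml; last first.
    move=> r; rewrite -EFinM lee_fin; exact: nnfun_muleindic_ge0.
  by congr (_ * _); rewrite fimfunE -fsumEFin.
- by move=> r; apply: emeasurable_funM => //; exact: emeasurable_funM.
- by move=> r x _; rewrite mule_ge0// -EFinM; exact: nnfun_muleindic_ge0.
Qed.

End image_density.

(** The hypothesis identifies two image densities of [P] under [Z], namely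
    those of [G] and of the constant [c]; integrating [phi] against both gives
    the conclusion. This is the step that replaces an indicator of [Z] by an
    arbitrary function of [Z] in a product formula. *)
Lemma integral_factor d (T : measurableType d) (R : realType)
    (P : {measure set T -> \bar R}) d' (Y : measurableType d')
    (G : T -> \bar R) (Z : T -> Y) (c : \bar R) (phi : Y -> \bar R) :
  measurable_fun setT G -> (forall w, 0 <= G w) -> measurable_fun setT Z ->
  0 <= c ->
  (forall B, measurable B ->
     \int[P]_(w in Z @^-1` B) G w = c * P (Z @^-1` B)) ->
  measurable_fun setT phi -> (forall y, 0 <= phi y) ->
  \int[P]_w (phi (Z w) * G w) = c * \int[P]_w phi (Z w).
Proof.
move=> mG G0 mZ c0 GZ mphi phi0.
have mphiZ : measurable_fun setT (phi \o Z) by exact: measurableT_comp.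
have mc : measurable_fun (@setT T) (cst c) by exact: measurable_cst.
have c0' : forall x : T, 0 <= cst c x by [].
rewrite -(ge0_integral_image_density P mG G0 mZ)//.
rewrite (eq_measure_integral (image_density P mc c0' mZ)); last first.
  move=> B mB _; rewrite [LHS]GZ//; apply/esym; apply: integral_cst.
  by rewrite -[_ @^-1` _]setTI; exact: mZ.
rewrite ge0_integral_image_density// -ge0_integralZl//.
by apply: eq_integral => w _; rewrite muleC.
Qed.

(** * Products of functions of independent variables *)

Lemma prod_indic (R : realType) (I : eqType) (T : Type) (Y : I -> Type)
    (s : seq I) (B : forall i, set (Y i)) (Z : forall i, T -> Y i) w :
  (\prod_(i <- s) \1_(B i) (Z i w))%R =
  \1_[set w | forall i, i \in s -> B i (Z i w)] w :> R.
Proof.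
rewrite [RHS]indicE; have [/set_mem/= wB|/negP wB] := boolP (w \in _).
  by rewrite big_seq; apply: big1 => j sj; rewrite indicE mem_set//; exact: wB.
have [i [si wBi]] : exists i, i \in s /\ ~ B i (Z i w).
  apply: contrapT => wB'; apply: wB; apply/mem_set => i si.
  by apply: contrapT => wBi; apply: wB'; exists i.
by rewrite (perm_big _ (perm_to_rem si)) big_cons/= indicE (memNset wBi) mul0r.
Qed.

Section independence.
Context (R : realType) d (Omega : measurableType d) (P : probability Omega R)
  (I : choiceType) (dY : I -> measure_display)
  (Y : forall i, measurableType (dY i)) (Z : forall i, Omega -> Y i).
Hypotheses (mZ : forall i, measurable_fun setT (Z i))
  (indZ : mutually_independent P Z).

Lemma independent_rectangle (s : seq I) (B : forall i, set (Y i)) :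
  uniq s -> (forall i, i \in s -> measurable (B i)) ->
  P [set w | forall i, i \in s -> B i (Z i w)] =
  \prod_(i <- s) P (Z i @^-1` B i).
Proof.
move=> us mB; have sE i : (i \in [fset j in s]%fset) = (i \in s) by rewrite inE.
rewrite (_ : [set w | _] =
    \bigcap_(i in [set` [fset j in s]%fset]) (Z i @^-1` B i)).
  rewrite (indZ (J := [fset j in s]%fset))//; last first.
    by move=> i; rewrite sE; exact: mB.
  by apply: perm_big; apply: uniq_perm.
apply/seteqP; split => w /= sB i.
  by rewrite /= sE => /sB.
by move=> si; apply: sB; rewrite /= sE.
Qed.

(** For indicators this is the definition of independence, and [integral_factor]
    turns the indicators into general functions one index at a time. *)
Lemma integral_independent_prod (s : seq I) (phi : forall i, Y i -> R) :
  uniq s -> (forall i, measurable_fun setT (phi i)) ->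
  (forall i y, (0 <= phi i y)%R) ->
  \int[P]_w (\prod_(i <- s) phi i (Z i w))%:E =
  \prod_(i <- s) \int[P]_w (phi i (Z i w))%:E.
Proof.
(* [s1] holds the factors that are arbitrary functions, [s2] those that are
   still indicators *)
move=> us; rewrite -(cats0 s) in us *.
have : forall i, i \in [::] -> exists2 B, measurable B & phi i = \1_B by [].
elim: s [::] phi us => [|i s1 IH] s2 phi /= us phi1 mphi phi0.
  (* recovers the set from its indicator *)
  pose B i := phi i @^-1` [set 1%R].
  have mB i : measurable (B i).
    by rewrite -[B i]setTI; apply: mphi.
  have phiE i : i \in s2 -> phi i = \1_(B i).
    move=> /phi1[C mC phiC]; rewrite /B phiC; congr (\1_ _).
    apply/seteqP; split => y /=; rewrite indicE; first by move=> /mem_set ->.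
    by have [/set_mem//|_ /eqP] := boolP (y \in C); rewrite eq_sym oner_eq0.
  transitivity (P [set w | forall i, i \in s2 -> B i (Z i w)]).
    rewrite -[in RHS](setIT [set w | _]) -integral_indic//; last first.
      rewrite (_ : [set w | _] = \bigcap_(i in [set` s2]) (Z i @^-1` B i))//.
      apply: fin_bigcap_measurable => // i _.
      by rewrite -[_ @^-1` _]setTI; exact: mZ.
    apply: eq_integral => w _; congr (_%:E); rewrite -prod_indic.
    by apply: eq_big_seq => i si; rewrite (phiE i si).
  rewrite independent_rectangle//; apply: eq_big_seq => j js.
  rewrite (phiE j)//.
  transitivity (\int[P]_w (\1_(Z j @^-1` B j) w)%:E).
    rewrite integral_indic// ?setIT//.
    by rewrite -[_ @^-1` _]setTI; exact: mZ.
  by apply: eq_integral => w _; rewrite indic_preimage.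
rewrite big_cons.
under eq_integral do rewrite big_cons EFinM.
rewrite muleC.
have mG : measurable_fun setT
    (fun w => (\prod_(j <- s1 ++ s2) phi j (Z j w))%:E).
  apply/measurable_EFinP; apply: measurable_prod => j _.
  exact: measurableT_comp.
apply: (integral_factor (phi := fun y => (phi i y)%:E)) => //.
- by move=> w; rewrite lee_fin prodr_ge0.
- by apply: prode_ge0 => j _; apply: integral_ge0 => w _; rewrite lee_fin.
- move=> B mB.
  (* the induction hypothesis, with [i] moved among the indicators *)
  pose phi' : forall j, Y j -> R := dfwith phi i (\1_B : Y i -> R).
  have phi'i : phi' i = \1_B by rewrite /phi' dfwithin.
  have phi'j j : j != i -> phi' j = phi j.
    by move=> ji; rewrite /phi' dfwithout// eq_sym.
  have iN j : j \in s1 ++ s2 -> j != i.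
    by move=> js; apply: contraNneq (proj1 (andP us)) => <-.
  have pE : perm_eq (s1 ++ i :: s2) (i :: s1 ++ s2).
    by rewrite -cat1s perm_catCA.
  have iE : \int[P]_w (phi' i (Z i w))%:E = P (Z i @^-1` B).
    rewrite phi'i; under eq_integral do rewrite -indic_preimage.
    by rewrite integral_indic// ?setIT// -[_ @^-1` _]setTI; exact: mZ.
  transitivity (\int[P]_w (\prod_(j <- s1 ++ i :: s2) phi' j (Z j w))%:E).
    rewrite integral_mkcond; apply: eq_integral => w _.
    rewrite (perm_big _ pE) big_cons/= phi'i patchE -indic_preimage indicE.
    case: ifPn => _; rewrite ?mul0r// mul1r; congr _%:E.
    by apply: eq_big_seq => j /iN/phi'j ->.
  rewrite IH//.
  - rewrite (perm_big _ pE) big_cons/= iE muleC; congr (_ * _).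
    by apply: eq_big_seq => j /iN/phi'j ->.
  - by rewrite (perm_uniq pE).
  - move=> j; rewrite inE => /predU1P[->|js]; first by exists B.
    rewrite phi'j; first exact: phi1.
    by apply: iN; rewrite mem_cat js orbT.
  - move=> j; have [->|/phi'j->//] := eqVneq j i.
    by rewrite phi'i; exact: measurable_indic.
  - move=> j y; have [ji|/phi'j->//] := eqVneq j i.
    by move: y; rewrite ji => y; rewrite phi'i indicE.
- by apply/measurable_EFinP.
- by move=> y; rewrite lee_fin.
Qed.
End independence.

(** * The observed filtration and its rectangles *)

(** Both sides are finite measures of [E], and [G] is a pi-system. *)
Lemma eq_integral_sigma_algebra d (T : measurableType d) (R : realType)
    (m1 m2 : {measure set T -> \bar R}) (G : set (set T))
    (g1 g2 : T -> \bar R) :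
  measurable_fun setT g1 -> (forall x, 0 <= g1 x) ->
  measurable_fun setT g2 -> (forall x, 0 <= g2 x) ->
  G `<=` measurable -> setI_closed G -> G setT ->
  \int[m1]_x g1 x < +oo ->
  (forall E, G E -> \int[m1]_(x in E) g1 x = \int[m2]_(x in E) g2 x) ->
  forall E, <<s G >> E -> \int[m1]_(x in E) g1 x = \int[m2]_(x in E) g2 x.
Proof.
move=> mg1 g10 mg2 g20 Gm GI GT fin1 eqG E sE.
have mid : measurable_fun (@setT T) (@idfun T) by exact: measurable_id.
pose n1 := image_density m1 mg1 g10 mid.
pose n2 := image_density m2 mg2 g20 mid.
apply: (@g_sigma_algebra_measure_unique_trace _ _ _ G setT _ _ _ n1 n2) => //.
- by move=> X [/Gm mX _].
- by move=> X Y [GX _] [GY _]; split => //; exact: GI.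
- exact: eqG.
- by move=> X [/eqG eX _].
- have GE : G `<=` [set X | G X /\ X `<=` setT] by move=> X GX; split.
  exact: (sub_sigma_algebra2 GE).
Qed.

Section streams_model.
Context (R : realType) (K : nat) (dX : 'I_K -> measure_display)
  (X : forall k, measurableType (dX k))
  (d : measure_display) (Omega : measurableType d)
  (obs : nat -> forall k, Omega -> X k).
Hypothesis obs_measurable : forall s k, measurable_fun [set: Omega] (obs s k).

Definition times_streams (n : nat) : seq (nat * 'I_K) :=
  [seq (s, k) | s <- iota 0 n, k <- enum 'I_K].

Definition rectangle (n : nat) (B : forall i : nat * 'I_K, set (X i.2))
  : set Omega :=
  [set w | forall i, i \in times_streams n -> B i (obs i.1 i.2 w)].

(** With [r] a ratio of densities, this is the likelihood ratio of all
    observations up to time [n]; a stream whose law does not change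
    contributes factors 1 where its density is positive. *)
Definition obs_prod (r : forall k, X k -> R) (n : nat) (w : Omega) : R :=
  (\prod_(i <- times_streams n) r i.2 (obs i.1 i.2 w))%R.

Lemma mem_times_streams n i : (i \in times_streams n) = (i.1 < n)%N.
Proof.
apply/allpairsP/idP => [[[s k] [/= + _ ->]]|i1n]; first by rewrite mem_iota.
by exists i; split; rewrite ?mem_iota ?mem_enum//; case: i {i1n}.
Qed.

Lemma uniq_times_streams n : uniq (times_streams n).
Proof.
by apply: allpairs_uniq; [exact: iota_uniq|exact: enum_uniq|move=> [? ?] [? ?]].
Qed.

Lemma times_streamsS n :
  times_streams n.+1 = times_streams n ++ [seq (n, k) | k <- enum 'I_K].
Proof. by rewrite /times_streams -addn1 iotaD map_cat flatten_cat/= cats0. Qed.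

Lemma measurable_obs_prod r n : (forall k, measurable_fun setT (r k)) ->
  measurable_fun setT (obs_prod r n).
Proof.
move=> mr; apply: measurable_prod => i _; exact: measurableT_comp.
Qed.

Lemma obs_prod_ge0 r n w :
  (forall k x, (0 <= r k x)%R) -> (0 <= obs_prod r n w)%R.
Proof. by move=> r0; apply: prodr_ge0. Qed.

Lemma measurable_rectangle n B : (forall i, measurable (B i)) ->
  measurable (rectangle n B).
Proof.
move=> mB; rewrite (_ : rectangle n B = \bigcap_(i in [set` times_streams n])
  (obs i.1 i.2 @^-1` B i))//.
apply: fin_bigcap_measurable => // i _.
by rewrite -[_ @^-1` _]setTI; exact: obs_measurable.
Qed.

Definition rectangles n : set (set Omega) :=
  [set E | exists2 B, (forall i, measurable (B i)) & E = rectangle n B].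

Lemma rectangles_setT n : rectangles n setT.
Proof. by exists (fun=> setT) => //; apply/seteqP; split. Qed.

Lemma rectangles_setI n : setI_closed (rectangles n).
Proof.
move=> _ _ [B mB ->] [C mC ->]; exists (fun i => B i `&` C i).
  by move=> i; exact: measurableI.
apply/seteqP; split => w /= => [[wB wC] i ni|wBC].
  by split; [exact: wB|exact: wC].
by split => i /wBC[].
Qed.

(** The generators of the filtration constrain one observation at a time, and
    so do not form a pi-system; rectangles do and generate at least as much.
    *)
Lemma filtration_rectangles n : filtration obs n `<=` <<s rectangles n >>.
Proof.
apply: smallest_sub; first exact: smallest_sigma_algebra.
move=> _ [s [k [B [sn mB ->]]]]; apply: sub_gen_smallest.
exists (dfwith (fun i : nat * 'I_K => @setT (X i.2)) (s, k) B).
  by move=> i; case: dfwithP.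
apply/seteqP; split => w /=.
  by move=> Bw i _; case: dfwithP.
move=> /(_ (s, k)); rewrite dfwithin mem_times_streams; exact.
Qed.

Lemma filtration_measurable n : filtration obs n `<=` measurable.
Proof.
apply: smallest_sub; first exact: sigma_algebra_measurable.
move=> _ [s [k [B [_ mB ->]]]].
by rewrite -[_ @^-1` _]setTI; exact: obs_measurable.
Qed.

Lemma filtration_le m n : (m <= n)%N -> filtration obs m `<=` filtration obs n.
Proof.
move=> mn; apply: sub_sigma_algebra2 => _ [s [k [B [sm mB ->]]]].
by exists s, k, B; split => //; exact: leq_trans mn.
Qed.

End streams_model.

Lemma prode_le1 (R : realType) (I : Type) (s : seq I) (a : I -> \bar R) :
  (forall i, 0 <= a i <= 1) -> \prod_(i <- s) a i <= 1.
Proof.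
move=> a01; suff : 0 <= \prod_(i <- s) a i <= 1 by case/andP.
elim/big_ind : _ => [|x y /andP[x0 x1] /andP[y0 y1]|i _]; last exact: a01.
  by rewrite lee01 lexx.
by rewrite mule_ge0//= -[leRHS]mule1 lee_pmul.
Qed.

(** * Change of measure and Hellinger affinity *)

Section law.
Context (R : realType) (K : nat) (dX : 'I_K -> measure_display)
  (X : forall k, measurableType (dX k))
  (mu : forall k, {measure set X k -> \bar R})
  (d : measure_display) (Omega : measurableType d)
  (obs : nat -> forall k, Omega -> X k).
Hypothesis obs_measurable : forall s k, measurable_fun [set: Omega] (obs s k).
Arguments obs_measurable : clear implicits.
Variables (g : forall k, X k -> R) (P : probability Omega R).
Arguments g : clear implicits.
Hypotheses (mg : forall k, measurable_fun setT (g k))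
  (g0 : forall k x, (0 <= g k x)%R) (P_law : is_law obs mu g P).

Lemma integral_law s k (phi : X k -> R) : measurable_fun setT phi ->
  (forall x, (0 <= phi x)%R) ->
  \int[P]_w (phi (obs s k w))%:E = \int[mu k]_x (phi x * g k x)%:E.
Proof.
move=> mphi phi0.
have mg' : measurable_fun setT (EFin \o g k) by exact/measurable_EFinP.
have g0' x : 0 <= (EFin \o g k) x by rewrite lee_fin.
have m1 : measurable_fun (@setT Omega) (@cst _ (\bar R) 1).
  exact: measurable_cst.
have m1_ge0 (w : Omega) : 0 <= cst 1 w :> \bar R by rewrite /= lee01.
have mid : measurable_fun (@setT (X k)) (@idfun (X k)) by exact: measurable_id.
have mphi' : measurable_fun setT (EFin \o phi) by exact/measurable_EFinP.
have phi0' x : 0 <= (EFin \o phi) x by rewrite lee_fin.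
transitivity
  (\int[image_density P m1 m1_ge0 (obs_measurable s k)]_x (phi x)%:E).
  rewrite ge0_integral_image_density//.
  by apply: eq_integral => w _; rewrite /= mule1.
transitivity (\int[image_density (mu k) mg' g0' mid]_x (phi x)%:E); last first.
  by rewrite ge0_integral_image_density.
apply: eq_measure_integral => B mB _; have [PE _] := P_law.
transitivity (1 * P (obs s k @^-1` B)); last by rewrite mul1e PE.
apply: (@integral_cst _ _ _ P (obs s k @^-1` B) _ 1).
by rewrite -[_ @^-1` _]setTI; exact: obs_measurable.
Qed.

Lemma integral_rectangle (r : forall k, X k -> R) n
    (B : forall i : nat * 'I_K, set (X i.2)) :
  (forall k, measurable_fun setT (r k)) -> (forall k x, (0 <= r k x)%R) ->
  (forall i, measurable (B i)) ->
  \int[P]_(w in rectangle obs n B) (obs_prod obs r n w)%:E =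
  \prod_(i <- times_streams K n)
     \int[mu i.2]_(x in B i) (r i.2 x * g i.2 x)%:E.
Proof.
move=> mr r0 mB.
pose phi (i : nat * 'I_K) (x : X i.2) := (\1_(B i) x * r i.2 x)%R.
have mphi i : measurable_fun setT (phi i).
  by apply: measurable_funM => //; exact: measurable_indic.
have phi0 i x : (0 <= phi i x)%R by rewrite mulr_ge0// indicE.
transitivity
  (\int[P]_w (\prod_(i <- times_streams K n) phi i (obs i.1 i.2 w))%:E).
  rewrite integral_mkcond; apply: eq_integral => w _; rewrite patchE.
  rewrite big_split/= EFinM -/(obs_prod obs r n w).
  rewrite (prod_indic R _ _ (fun i => obs i.1 i.2)) indicE.
  rewrite -/(rectangle obs n B).
  by case: ifPn => _; rewrite ?mul1e// mul0e.
case: P_law => _ ind.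
rewrite (integral_independent_prod (fun i => obs_measurable i.1 i.2) ind
  (uniq_times_streams K n) mphi phi0).
apply: eq_bigr => i _; rewrite integral_law//.
rewrite [RHS]integral_mkcond; apply: eq_integral => x _.
by rewrite patchE /phi indicE; case: ifPn => _; rewrite ?mul1r// mul0r mul0r.
Qed.

End law.

Section change_of_measure.
Context (R : realType) (K : nat) (dX : 'I_K -> measure_display)
  (X : forall k, measurableType (dX k))
  (mu : forall k, {measure set X k -> \bar R})
  (d : measure_display) (Omega : measurableType d)
  (obs : nat -> forall k, Omega -> X k).
Hypothesis obs_measurable : forall s k, measurable_fun [set: Omega] (obs s k).
Arguments obs_measurable : clear implicits.
Variables (p q : forall k, X k -> R) (P Q : probability Omega R).
Arguments p : clear implicits.
Arguments q : clear implicits.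
Hypotheses (p_density : forall k, is_density (mu k) (p k))
  (q_density : forall k, is_density (mu k) (q k))
  (P_law : is_law obs mu p P) (Q_law : is_law obs mu q Q).

Let mp k : measurable_fun setT (p k). Proof. by case: (p_density k). Qed.
Let mq k : measurable_fun setT (q k). Proof. by case: (q_density k). Qed.
Let p0 k x : (0 <= p k x)%R. Proof. by case: (p_density k). Qed.
Let q0 k x : (0 <= q k x)%R. Proof. by case: (q_density k). Qed.

Definition lik_ratio k (x : X k) : R := (q k x / p k x)%R.

Definition sqrt_lik_ratio k (x : X k) : R := Num.sqrt (lik_ratio x).

Lemma lik_ratio_ge0 k (x : X k) : (0 <= lik_ratio x)%R.
Proof. by rewrite divr_ge0. Qed.

Lemma measurable_lik_ratio k : measurable_fun setT (@lik_ratio k).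
Proof.
rewrite (_ : @lik_ratio k = (fun x => q k x * (p k x) `^ (-1))%R).
  apply: measurable_funM => //.
  exact: (measurableT_comp (measurable_powR _)).
by apply/funext => x; rewrite powR_inv1.
Qed.

Lemma measurable_sqrt_lik_ratio k : measurable_fun setT (@sqrt_lik_ratio k).
Proof.
rewrite (_ : @sqrt_lik_ratio k = (fun x : X k => lik_ratio x `^ 2^-1)%R).
  apply: (measurableT_comp (measurable_powR _)); exact: measurable_lik_ratio.
by apply/funext => x; rewrite powR12_sqrt// lik_ratio_ge0.
Qed.

(** On rectangles the two sides factor over the observations. There [q / p *
    p] is [q] off the zeros of [p] and 0 on them, so that the left side is
    exactly [Q (E `&` Pos)], with [Pos] the event that no observed density [p]
    vanishes. This identity, unlike the inequality, extends from rectangles to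
    the filtration. *)
Lemma change_of_measure n E : filtration obs n E ->
  \int[P]_(w in E) (obs_prod obs lik_ratio n w)%:E <= Q E.
Proof.
move=> FE; pose pos (i : nat * 'I_K) : set (X i.2) := [set x | p i.2 x != 0%R].
have mpos i : measurable (pos i).
  rewrite (_ : pos i = setT `&` p i.2 @^-1` (~` [set 0%R])).
    by apply: mp => //; exact: measurableC.
  by rewrite setTI; apply/seteqP; split => x /= /eqP.
have mPos : measurable (rectangle obs n pos) by exact: measurable_rectangle.
have rectE B : (forall i, measurable (B i)) ->
    \int[P]_(w in rectangle obs n B) (obs_prod obs lik_ratio n w)%:E =
    Q (rectangle obs n (fun i => B i `&` pos i)).
  move=> mB.
  rewrite (integral_rectangle obs_measurable mp p0 P_law)//; last 2 first.
  - exact: measurable_lik_ratio.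
  - exact: lik_ratio_ge0.
  have [Q1 Q2] := Q_law.
  rewrite (independent_rectangle Q2 (uniq_times_streams K n)
    (B := fun i => B i `&` pos i)).
    apply: eq_bigr => i _; rewrite Q1; last exact: measurableI.
    rewrite integral_mkcondr; apply: eq_integral => x _.
    rewrite patchE; case: ifPn => [/set_mem/= px|/negP px].
      by rewrite /lik_ratio divfK.
    have -> : p i.2 x = 0%R.
      by apply: contrapT => /eqP px'; apply: px; exact/mem_set.
    by rewrite mulr0.
  by move=> i _; exact: measurableI.
rewrite (@eq_integral_sigma_algebra _ _ _ _ Q (rectangles obs n) _
   (EFin \o \1_(rectangle obs n pos)))//.
- have mE := filtration_measurable obs_measurable FE.
  rewrite integral_indic//.
  by apply: le_measure => //; rewrite ?inE//; exact: measurableI.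
- apply/measurable_EFinP/measurable_obs_prod => //; exact: measurable_lik_ratio.
- by move=> w; rewrite lee_fin obs_prod_ge0//; exact: lik_ratio_ge0.
- by apply/measurable_EFinP; exact: measurable_indic.
- by move=> w; rewrite lee_fin.
- by move=> _ [B mB ->]; exact: measurable_rectangle.
- exact: rectangles_setI.
- exact: rectangles_setT.
- have [B mB ->] := rectangles_setT obs n.
  rewrite rectE//.
  apply: (le_lt_trans (probability_le1 _ _)); last by rewrite ltry.
  by apply: measurable_rectangle => // i; exact: measurableI.
- move=> _ [B mB ->]; rewrite rectE// integral_indic//; last first.
    exact: measurable_rectangle.
  congr (Q _); apply/seteqP; split => w /= => [wB|[wp wB] i si].
    by split => i /wB[].
  by split; [exact: wB|exact: wp].
- exact: filtration_rectangles.
Qed.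

(** The Hellinger affinity of the densities [p] and [q], written as the mean of
    [sqrt (q / p)] under the law with density [p]. *)
Definition affinity k : \bar R := \int[mu k]_x (sqrt_lik_ratio x * p k x)%:E.

Lemma affinity_ge0 k : 0 <= affinity k.
Proof. by apply: integral_ge0 => x _; rewrite lee_fin mulr_ge0// sqrtr_ge0. Qed.

Lemma sqrt_lik_ratio_mean k (x : X k) :
  (sqrt_lik_ratio x * p k x)%R = (Num.sqrt (q k x) * Num.sqrt (p k x))%R.
Proof.
have [px|px] := eqVneq (p k x) 0%R; first by rewrite px sqrtr0 !mulr0.
rewrite /sqrt_lik_ratio sqrtrM// sqrtrV// -mulrA; congr *%R.
rewrite -{2}[p k x]sqr_sqrtr// expr2 mulKf// sqrtr_eq0 -ltNge lt0r px.
exact: p0.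
Qed.

Definition hellinger k (x : X k) : R :=
  (2^-1 * (Num.sqrt (q k x) - Num.sqrt (p k x)) ^+ 2)%R.

Lemma measurable_hellinger k : measurable_fun setT (@hellinger k).
Proof.
apply: measurable_funM => //; apply: measurable_funX; apply: measurable_funB.
  rewrite (_ : (fun x => _) = (fun x => q k x `^ 2^-1)%R).
    by apply: (measurableT_comp (measurable_powR _)).
  by apply/funext => x; rewrite powR12_sqrt.
rewrite (_ : (fun x => _) = (fun x => p k x `^ 2^-1)%R).
  by apply: (measurableT_comp (measurable_powR _)).
by apply/funext => x; rewrite powR12_sqrt.
Qed.

Lemma hellinger_ge0 k (x : X k) : (0 <= hellinger x)%R.
Proof. by rewrite mulr_ge0// sqr_ge0. Qed.

(** Integrating the identity
    [sqrt p * sqrt q + (sqrt q - sqrt p) ^+ 2 / 2 = (p + q) / 2]. *)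
Lemma affinity_hellinger k :
  affinity k + \int[mu k]_x (hellinger x)%:E = 1.
Proof.
have [_ _ p1] := p_density k; have [_ _ q1] := q_density k.
have mp' : measurable_fun setT (fun x => (p k x)%:E) by exact/measurable_EFinP.
have mq' : measurable_fun setT (fun x => (q k x)%:E) by exact/measurable_EFinP.
have -> : 1 = (2^-1)%:E * (1 + 1) :> \bar R.
  by rewrite -EFinD -EFinM mulVf.
rewrite -{1}p1 -q1 -ge0_integralD//; last 4 first.
- by move=> x _; rewrite lee_fin mulr_ge0// sqrtr_ge0.
- apply/measurable_EFinP/measurable_funM => //.
  exact: measurable_sqrt_lik_ratio.
- by move=> x _; rewrite lee_fin hellinger_ge0.
- by apply/measurable_EFinP; exact: measurable_hellinger.
rewrite -ge0_integralD//; last 2 first.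
- by move=> x _; rewrite lee_fin.
- by move=> x _; rewrite lee_fin.
rewrite -ge0_integralZl//; last 2 first.
- exact: emeasurable_funD.
- by move=> x _; rewrite -EFinD lee_fin addr_ge0.
apply: eq_integral => x _; rewrite -!EFinD -EFinM; congr _%:E.
rewrite sqrt_lik_ratio_mean /hellinger sqrrB !sqr_sqrtr//.
by field.
Qed.

Lemma affinity_le1 k : affinity k <= 1.
Proof.
rewrite -(affinity_hellinger k) leeDl// integral_ge0// => x _.
by rewrite lee_fin hellinger_ge0.
Qed.

Lemma affinity_lt1 k :
  ~ {ae mu k, forall x, p k x = q k x} -> affinity k < 1.
Proof.
move=> pq; rewrite lt_neqAle affinity_le1 andbT.
apply: contra_notN pq => /eqP a1.
have h0 : \int[mu k]_x (hellinger x)%:E = 0.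
  have := affinity_hellinger k; rewrite a1.
  have : 0 <= \int[mu k]_x (hellinger x)%:E.
    by apply: integral_ge0 => x _; rewrite lee_fin hellinger_ge0.
  case: integral => [r| |]// _; rewrite -EFinD => -[h1].
  by congr _%:E; lra.
have : \int[mu k]_x `|(hellinger x)%:E| = 0.
  rewrite -[RHS]h0; apply: eq_integral => x _.
  by rewrite gee0_abs// lee_fin hellinger_ge0.
move/(ae_eq_integral_abs (mu k) measurableT).
have mh : measurable_fun setT (fun x : X k => (hellinger x)%:E).
  by apply/measurable_EFinP; exact: measurable_hellinger.
move=> /(_ mh) h1; move: h1; apply: filterS => x /(_ I) [] /eqP.
rewrite mulf_eq0 invr_eq0 pnatr_eq0/= sqrf_eq0 subr_eq0 => /eqP qp.
by rewrite -[LHS]sqr_sqrtr// -qp sqr_sqrtr.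
Qed.

(** The square root of the likelihood ratio contracts at each step by the
    product of the affinities, whatever happened in the past. Both sides are
    measures of [E], so that rectangles suffice. *)
Lemma integral_sqrt_lik_ratio n E : filtration obs n E ->
  \int[P]_(w in E) (obs_prod obs sqrt_lik_ratio n.+1 w)%:E =
  (\prod_k affinity k) *
    \int[P]_(w in E) (obs_prod obs sqrt_lik_ratio n w)%:E.
Proof.
move=> FE; have s0 k x : (0 <= @sqrt_lik_ratio k x)%R by exact: sqrtr_ge0.
have ms m : measurable_fun setT (fun w => (obs_prod obs sqrt_lik_ratio m w)%:E).
  apply/measurable_EFinP/measurable_obs_prod => //.
  exact: measurable_sqrt_lik_ratio.
have sp0 m w : 0 <= (obs_prod obs sqrt_lik_ratio m w)%:E.
  by rewrite lee_fin obs_prod_ge0.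
have aff0 : 0 <= \prod_k affinity k.
  by apply: prode_ge0 => k _; exact: affinity_ge0.
have Em := filtration_measurable obs_measurable FE.
rewrite -ge0_integralZl//; last exact: measurable_funTS.
have rectE B : (forall i, measurable (B i)) ->
    \int[P]_(w in rectangle obs n B) (obs_prod obs sqrt_lik_ratio n.+1 w)%:E =
    \int[P]_(w in rectangle obs n B)
      ((\prod_k affinity k) * (obs_prod obs sqrt_lik_ratio n w)%:E).
  move=> mB; pose B' (i : nat * 'I_K) := if (i.1 < n)%N then B i else setT.
  have mB' i : measurable (B' i) by rewrite /B'; case: ifP.
  have rE : rectangle obs n B = rectangle obs n.+1 B'.
    apply/seteqP; split => w /= wB i.
      rewrite /B'; case: ifPn => // ni _.
      by apply: wB; rewrite mem_times_streams.
    move=> /[!mem_times_streams] ni; have := wB i.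
    by rewrite /B' ni; apply; rewrite mem_times_streams ltnS ltnW.
  rewrite ge0_integralZl//; last 2 first.
  - exact: measurable_rectangle.
  - exact: measurable_funTS.
  rewrite [in LHS]rE.
  rewrite !(integral_rectangle obs_measurable mp p0 P_law)//; last 2 first.
  - exact: measurable_sqrt_lik_ratio.
  - exact: measurable_sqrt_lik_ratio.
  rewrite times_streamsS big_cat/= muleC; congr (_ * _).
    rewrite big_map big_enum; apply: eq_bigr => k _.
    by rewrite /B' ltnn.
  by apply: eq_big_seq => i; rewrite mem_times_streams /B' => ->.
apply: (@eq_integral_sigma_algebra _ _ _ P P (rectangles obs n)) => //.
- exact: measurable_funeM.
- by move=> w; rewrite mule_ge0.
- by move=> _ [B mB ->]; exact: measurable_rectangle.
- exact: rectangles_setI.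
- exact: rectangles_setT.
- rewrite (_ : setT = rectangle obs n.+1 (fun=> setT)); last first.
    by apply/seteqP; split.
  rewrite (integral_rectangle obs_measurable mp p0 P_law)//; last first.
    exact: measurable_sqrt_lik_ratio.
  apply: (@le_lt_trans _ _ 1); last by rewrite ltry.
  by apply: prode_le1 => i; rewrite affinity_ge0 affinity_le1.
- by move=> _ [B mB ->]; exact: rectE.
- exact: filtration_rectangles.
Qed.

End change_of_measure.

(** * Series and first passage times *)

Lemma nneseries_le_ub (R : realType) (a : nat -> \bar R) (M : \bar R) :
  (forall n, 0 <= a n) -> (forall n, \sum_(0 <= i < n) a i <= M) ->
  \sum_(i <oo) a i <= M.
Proof.
move=> a0 aM; apply: lime_le; first exact: is_cvg_nneseries.
by apply: nearW => n; exact: aM.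
Qed.

Lemma nneseries_le_geometric (R : realType) (a : nat -> \bar R) (theta : R) :
  (forall n, 0 <= a n) -> (0 <= theta < 1)%R ->
  (forall n, a n.+1 <= theta%:E * a n) ->
  \sum_(n <oo) a n <= ((1 - theta)^-1)%:E * a 0%N.
Proof.
move=> a0 /andP[t0 t1] at_; apply: nneseries_le_ub => // n.
have c0 : (0 <= (1 - theta)^-1)%R by rewrite invr_ge0 subr_ge0 ltW.
elim: n => [|n IH]; first by rewrite big_nil mule_ge0.
rewrite big_nat_recl//.
apply: (@le_trans _ _ (a 0%N + theta%:E * \sum_(0 <= i < n) a i)).
  rewrite leeD2l// ge0_sume_distrr//; exact: lee_sum.
apply: (@le_trans _ _ (a 0%N + theta%:E * (((1 - theta)^-1)%:E * a 0%N))).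
  by rewrite leeD2l// lee_wpmul2l.
rewrite muleA -[X in X + _]mul1e -ge0_muleDl ?lee01//; last first.
  by rewrite -EFinM lee_fin mulr_ge0.
rewrite lee_wpmul2r// -EFinM -EFinD lee_fin.
rewrite le_eqVlt; apply/orP; left; apply/eqP.
by field; rewrite subr_eq0 gt_eqF.
Qed.

(** If a penalty of at least 1 is charged at each time from [n] on at which the
    event has not yet occurred, the total penalty is at least the remaining
    waiting time. *)
Lemma first_time_le (R : realType) (Q : pred nat) n (g : nat -> \bar R) :
  (forall j, 0 <= g j) -> (forall j, ~~ Q (n + j)%N -> 1 <= g j) ->
  oapp (fun t => t%:R%:E) +oo (first_time Q) <= n%:R%:E + \sum_(j <oo) g j.
Proof.
move=> g0 Qg.
have le_series J : (forall j, (j < J)%N -> ~~ Q (n + j)%N) ->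
    J%:R%:E <= \sum_(j <oo) g j.
  move=> QJ; apply: le_trans (nneseries_lim_ge J _); last first.
    by move=> j _ _; exact: g0.
  apply: (@le_trans _ _ (\sum_(0 <= j < J) (1 : \bar R))).
    by rewrite big_mkord sumEFin sumr_const card_ord.
  rewrite big_nat [leRHS]big_nat.
  by apply: lee_sum => j /andP[_ jJ]; exact: Qg (QJ _ jJ).
have S0 : 0 <= \sum_(j <oo) g j by apply: nneseries_ge0.
rewrite /first_time; case: pselect => [exQ|nQ] /=.
  case: ex_minnP => t _ tmin.
  have [tn|nt] := leqP t n.
    by rewrite -[leLHS]adde0 leeD// lee_fin ler_nat.
  rewrite -{1}(subnKC (ltnW nt)) natrD EFinD leeD2l//.
  apply: le_series => j jt; apply: contraTN jt => /tmin; rewrite -leqNgt.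
  by rewrite leq_subLR.
suff -> : \sum_(j <oo) g j = +oo by rewrite addey.
apply/eqyP => r r0; have [J rJ] : exists J, (r <= J%:R)%R.
  by exists (Num.truncn r).+1; exact: ltW (truncnS_gt r).
apply: (@le_trans _ _ J%:R%:E); first by rewrite lee_fin.
by apply: le_series => j _; apply/negP => Qnj; apply: nQ; exists (n + j)%N.
Qed.

(** * Log-likelihood ratios inside the continuation region *)

Section likelihood_ratio_bounds.
Context (R : realType).

Lemma lneM_EFin (x y : R) : (0 <= x)%R -> (0 <= y)%R ->
  lne (x * y)%:E = lne x%:E + lne y%:E.
Proof.
rewrite !le_eqVlt => /predU1P[<-|x0] /predU1P[<-|y0].
- by rewrite mul0r le0_lneNy.
- by rewrite mul0r le0_lneNy// lne_EFin.
- by rewrite mulr0 [lne 0]le0_lneNy// lne_EFin.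
- by rewrite !lne_EFin ?mulr_gt0// lnM.
Qed.

Lemma lne_EFin_lty (x : R) : lne x%:E < +oo.
Proof.
have [x0|x0] := leP x 0%R; first by rewrite le0_lneNy ?lee_fin ?ltNyr.
by rewrite lne_EFin ?ltry.
Qed.

(** Stated for an abstract [L] because it is applied to [lne] and to its
    opposite: as [lne 0] is infinite, the opposite of a sum of values of [lne]
    is not the sum of their opposites for purely formal reasons. *)
Lemma sum_morph_prod (L : R -> \bar R) t (u : nat -> R) :
  L 1%R = 0 ->
  (forall x y, (0 <= x)%R -> (0 <= y)%R -> L (x * y)%R = L x + L y) ->
  (forall s, (0 <= u s)%R) ->
  \sum_(s < t) L (u s) = L (\prod_(s < t) u s)%R.
Proof.
move=> L1 LM u0; elim: t => [|t IH]; first by rewrite !big_ord0.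
by rewrite !big_ord_recr/= IH LM// prodr_ge0.
Qed.

Lemma lne_prod t (u : nat -> R) : (forall s, (0 <= u s)%R) ->
  \sum_(s < t) lne (u s)%:E = lne (\prod_(s < t) u s)%:E.
Proof.
move=> u0; apply: (@sum_morph_prod (fun x => lne x%:E)) => //.
  exact: lne1.
exact: lneM_EFin.
Qed.

Lemma oppe_lne_prod t (u : nat -> R) : (forall s, (0 <= u s)%R) ->
  \sum_(s < t) - lne (u s)%:E = - lne (\prod_(s < t) u s)%:E.
Proof.
move=> u0; apply: (@sum_morph_prod (fun x => - lne x%:E)) => //.
  by rewrite lne1 oppe0.
move=> x y x0 y0; rewrite lneM_EFin//.
move: (lne_EFin_lty x) (lne_EFin_lty y).
case: lne => [r| |]//; case: lne => [r'| |]// _ _.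
by rewrite -!EFinN -!EFinD opprD.
Qed.

End likelihood_ratio_bounds.

Definition flip (K : nat) (A : {set 'I_K}) (k : 'I_K) : {set 'I_K} :=
  [set j | (j \in A) (+) (j == k)]%SET.

Lemma mem_flip (K : nat) (A : {set 'I_K}) k : (k \in flip A k) = ~~ (k \in A).
Proof. by rewrite inE eqxx addbT. Qed.

Section exit.
Context (R : realType) (K : nat) (dX : 'I_K -> measure_display)
  (X : forall k, measurableType (dX k)) (f : forall k, bool -> X k -> R).
Arguments f : clear implicits.
Context (d : measure_display) (Omega : measurableType d)
  (obs : nat -> forall k, Omega -> X k).
Hypothesis f_ge0 : forall k i x, (0 <= f k i x)%R.

Definition stream_density (A : {set 'I_K}) k : X k -> R := f k (k \in A).
Arguments stream_density : clear implicits.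

Definition flip_ratio A k : Omega -> nat -> R := fun w n =>
  obs_prod obs
    (@lik_ratio R K dX X (stream_density A) (stream_density (flip A k))) n w.

Definition sqrt_flip_ratio A k : Omega -> nat -> R := fun w n =>
  obs_prod obs
    (@sqrt_lik_ratio R K dX X (stream_density A) (stream_density (flip A k)))
    n w.

Lemma sqr_sqrt_flip_ratio A k w n :
  (sqrt_flip_ratio A k w n ^+ 2 = flip_ratio A k w n)%R.
Proof.
rewrite /sqrt_flip_ratio /flip_ratio /obs_prod -prodrXl; apply: eq_bigr => i _.
by rewrite sqr_sqrtr// divr_ge0// f_ge0.
Qed.

Lemma sqrt_flip_ratio_ge0 A k w n : (0 <= sqrt_flip_ratio A k w n)%R.
Proof. by apply: obs_prod_ge0 => j x; exact: sqrtr_ge0. Qed.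

(** The conventions on [0^-1] and [lne 0] make the following two identities hold
    also when the second density vanishes. *)
Lemma log_ratio_neg (x y : R) : (0 < x)%R -> (0 <= y)%R ->
  lne (x%:E / y%:E) = - lne (y / x)%:E.
Proof.
move=> x0; rewrite le_eqVlt => /predU1P[<-|y0].
  by rewrite mul0r inve0 gt0_muley ?lte_fin// [lne 0]le0_lneNy.
rewrite inver (gt_eqF y0) -EFinM !lne_EFin ?divr_gt0// -EFinN; congr _%:E.
by rewrite -lnV ?posrE ?divr_gt0// invf_div.
Qed.

Lemma log_ratio_pos (x y : R) : (0 < x)%R -> (0 <= y)%R ->
  lne (y%:E / x%:E) = lne (y / x)%:E.
Proof. by move=> x0 y0; rewrite inver (gt_eqF x0). Qed.

(** The log-likelihood ratio of stream [k] is [lne L] when [k] is not in [A] and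
    [- lne L] otherwise, where [L] is the likelihood ratio of [flip A k] to
    [A]. Not having crossed the boundary on the side of the truth thus means
    [lne L > - h], and the claim is the square root of [expR h * L >= 1]. *)
Lemma sqrt_flip_ratio_exit A k t w a b h :
  (forall s j, stream_density A j (obs s j w) != 0%R) ->
  (a <= h)%R -> (b <= h)%R ->
  (- a)%:E < log_lik_ratio obs f t k w < b%:E ->
  (1 <= expR (h / 2) * sqrt_flip_ratio A k w t)%R.
Proof.
move=> Aw ah bh lamw.
have p_gt0 s j : (0 < stream_density A j (obs s j w))%R.
  by rewrite lt0r Aw f_ge0.
pose u s := @lik_ratio R K dX X (stream_density A)
  (stream_density (flip A k)) k (obs s k w).
have u0 s : (0 <= u s)%R by rewrite divr_ge0// f_ge0.
have ratioE : flip_ratio A k w t = (\prod_(s < t) u s)%R.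
  rewrite /flip_ratio /obs_prod big_allpairs.
  rewrite -[in RHS](big_mkord xpredT) /index_iota subn0.
  apply: eq_bigr => s _; rewrite big_enum/= (bigD1 k)//= big1 ?mulr1// => j jk.
  rewrite /lik_ratio /stream_density inE (negbTE jk) addbF.
  by rewrite divff// Aw.
have lamE : log_lik_ratio obs f t k w =
    (if k \in A then - lne (flip_ratio A k w t)%:E
     else lne (flip_ratio A k w t)%:E).
  rewrite ratioE; case: ifPn => kA.
    rewrite -oppe_lne_prod//; apply: eq_bigr => s _.
    have := p_gt0 s k.
    rewrite /log_ratio /u /lik_ratio /stream_density inE eqxx kA/=.
    by move=> p0; rewrite log_ratio_neg.
  rewrite -lne_prod//; apply: eq_bigr => s _.
  have := p_gt0 s k.
  rewrite /log_ratio /u /lik_ratio /stream_density inE eqxx (negbTE kA)/=.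
  by move=> p0; rewrite log_ratio_pos.
have lnU : (- h)%:E < lne (flip_ratio A k w t)%:E.
  move: lamw; rewrite lamE => /andP[]; case: ifPn => _.
    move=> _; rewrite lteNl => lb; apply: le_lt_trans lb.
    by rewrite -EFinN lee_fin lerN2.
  by move=> al _; apply: le_lt_trans al; rewrite lee_fin lerN2.
have Ugt0 : (0 < flip_ratio A k w t)%R.
  rewrite ltNge; apply/negP => U0.
  by move: lnU; rewrite le0_lneNy ?lee_fin// ltNge leNye.
rewrite lne_EFin// lte_fin in lnU.
have hU : (1 <= expR h * flip_ratio A k w t)%R.
  rewrite -[flip_ratio _ _ _ _]lnK ?posrE// -expRD -expR0 ler_expR.
  by rewrite -lerBlDl sub0r ltW.
rewrite -(@ler_pXn2r _ 2)// ?nnegrE ?mulr_ge0 ?expR_ge0 ?sqrt_flip_ratio_ge0//.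
rewrite expr1n exprMn sqr_sqrt_flip_ratio -expRM_natl.
by rewrite (_ : 2%:R * (h / 2) = h)%R// mulrC divfK.
Qed.

End exit.

(** * Stopping times *)

Section stopping_times.
Context (R : realType) (K : nat) (dX : 'I_K -> measure_display)
  (X : forall k, measurableType (dX k))
  (d : measure_display) (Omega : measurableType d)
  (obs : nat -> forall k, Omega -> X k).
Hypothesis obs_measurable : forall s k, measurable_fun [set: Omega] (obs s k).

Lemma filtrationD n E F : filtration obs n E -> filtration obs n F ->
  filtration obs n (E `\` F).
Proof. exact: (@measurableD _ (g_sigma_algebraType _)). Qed.

Lemma filtration0 n : filtration obs n set0.
Proof. exact: (@measurable0 _ (g_sigma_algebraType _)). Qed.

Lemma filtration_oo_measurable : filtration_oo obs `<=` measurable.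
Proof.
apply: smallest_sub; first exact: sigma_algebra_measurable.
by move=> E [n _]; exact: filtration_measurable.
Qed.

Variables (T : Omega -> option nat).
Hypothesis T_stop : stopping_time obs T.

Definition stops_at (n : nat) : set Omega := [set w | T w = Some n].

Lemma filtration_stops_atI n E :
  (forall t, (1 <= t)%N -> filtration obs t (E `&` time_le T t)) ->
  filtration obs n (E `&` stops_at n).
Proof.
have [T0 Tt] := T_stop; case: n => [|n] ET.
  rewrite (_ : _ `&` _ = set0); first exact: filtration0.
  by rewrite -subset0 => w [_ /= Tw]; move: (T0 w); rewrite Tw eqxx.
have -> : E `&` stops_at n.+1 = (E `&` time_le T n.+1) `\` time_le T n.
  apply/seteqP; split => w /=; rewrite /time_le /=.
    by move=> [Ew ->] /=; rewrite leqnn ltnn.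
  move=> [[Ew Tw] Tw']; split => //; move: Tw Tw'; rewrite /stops_at /=.
  case: (T w) => [m|]//= mn mn'; congr Some; apply/eqP.
  by rewrite eqn_leq mn ltnNge; apply/negP.
apply: filtrationD; first exact: ET.
case: n {ET} => [|n].
  rewrite (_ : time_le T 0 = set0); first exact: filtration0.
  rewrite -subset0 => w /=; rewrite /time_le /=; move: (T0 w).
  by case: (T w) => [[|m]|].
by apply: (filtration_le (leqnSn n.+1)); exact: Tt.
Qed.

Lemma filtration_stops_at n : filtration obs n (stops_at n).
Proof.
have [_ Tt] := T_stop; rewrite -[stops_at n]setTI.
by apply: filtration_stops_atI => t t1; rewrite setTI; exact: Tt.
Qed.

Lemma measurable_stops_at n : measurable (stops_at n).
Proof.
apply: (filtration_measurable obs_measurable (n := n)).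
exact: filtration_stops_at.
Qed.

Lemma measurable_etime : measurable_fun setT (@etime R d Omega T).
Proof.
move=> _ B mB; rewrite setTI.
have -> : @etime R d Omega T @^-1` B =
    (\bigcup_(n in [set n | B n%:R%:E]) stops_at n) `|`
    ((\bigcap_n ~` stops_at n) `&` [set _ | B +oo]).
  apply/seteqP; split => w /=.
    rewrite /etime; case Tw : (T w) => [n|] /= Bw; first by left; exists n.
    by right; split => // n _; rewrite /stops_at /= Tw.
  case=> [[n /= Bn Tw]|[nT Boo]]; first by rewrite /etime Tw.
  rewrite /etime; case Tw : (T w) => [n|]//=.
  by case: (nT n I).
apply: measurableU.
  by apply: bigcup_measurable => n _; exact: measurable_stops_at.
apply: measurableI.
  apply: bigcapT_measurable => n; apply: measurableC.
  exact: measurable_stops_at.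
have [Boo|Boo] := pselect (B +oo).
  by rewrite (_ : [set _ | _] = setT)//; apply/seteqP; split.
by rewrite (_ : [set _ | _] = set0)//; apply/seteqP; split.
Qed.

End stopping_times.

(** * Comparison of the Intersection rule with an arbitrary procedure *)

Section intersection_rule_bound.
Context (R : realType) (K : nat) (dX : 'I_K -> measure_display)
  (X : forall k, measurableType (dX k))
  (mu : forall k, {measure set X k -> \bar R})
  (f : forall k, bool -> X k -> R).
Arguments f : clear implicits.
Hypothesis f_density : forall k i, is_density (mu k) (f k i).
Context (d : measure_display) (Omega : measurableType d)
  (obs : nat -> forall k, Omega -> X k).
Hypothesis obs_measurable : forall s k, measurable_fun [set: Omega] (obs s k).
Variable P : {set 'I_K} -> probability Omega R.
Hypothesis P_law : forall A : {set 'I_K},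
     is_law obs mu (fun k => f k (k \in A)) (P A).
Hypothesis log_ratio_mean : forall k i,
     0 < \int[mu k]_x (log_ratio (f k i) (f k (~~ i)) x * (f k i x)%:E).

Let f0 k i x : (0 <= f k i x)%R. Proof. by case: (f_density k i). Qed.

Let sdens A : forall k, X k -> R := stream_density f A.
Arguments sdens : clear implicits.

Let sdens_density A k : is_density (mu k) (sdens A k).
Proof. exact: f_density. Qed.

Let sqrtL A k w n : R := sqrt_flip_ratio f obs A k w n.


(** If the two densities agreed almost everywhere, the log-ratio would vanish
    almost everywhere on the support and have mean 0. *)
Lemma densities_differ k i : ~ {ae mu k, forall x, f k i x = f k (~~ i) x}.
Proof.
move=> fE; have := log_ratio_mean k i; apply/negP; rewrite -leNgt.
rewrite integralE -[leRHS]sube0; apply: leeB; last by apply: integral_ge0.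
rewrite -[leRHS](integral0 (mu k) setT).
apply: ge0_ae_le_integral_lower => //.
move: fE; apply: filterS => x fx; rewrite funeposE.
suff -> : log_ratio (f k i) (f k (~~ i)) x * (f k i x)%:E = 0 by rewrite maxxx.
have [fx0|fx0] := eqVneq (f k i x) 0%R; first by rewrite fx0 mule0.
by rewrite /log_ratio -fx inver (negbTE fx0) -EFinM divff// lne1 mul0e.
Qed.

(** Flipping [k] leaves the other streams alone; their affinities are at most
    1. *)
Lemma flip_affinity A k : exists2 theta : R, (0 <= theta < 1)%R &
  \prod_j affinity mu (sdens A) (sdens (flip A k)) j <= theta%:E.
Proof.
have aff_ge0 j : 0 <= affinity mu (sdens A) (sdens (flip A k)) j.
  exact: affinity_ge0.
have aff_le1 j : affinity mu (sdens A) (sdens (flip A k)) j <= 1.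
  exact: affinity_le1.
have aff_lt1 : affinity mu (sdens A) (sdens (flip A k)) k < 1.
  apply: (affinity_lt1 (sdens_density A) (sdens_density (flip A k))).
  rewrite /sdens /stream_density mem_flip.
  exact: densities_differ.
exists (fine (affinity mu (sdens A) (sdens (flip A k)) k)).
  move: (aff_ge0 k) aff_lt1; case: affinity => [r| |]//=.
  by rewrite lee_fin lte_fin => -> ->.
rewrite fineK; last by rewrite ge0_fin_numE// (lt_trans aff_lt1)// ltry.
rewrite (bigD1 k)//= -[leRHS]mule1; apply: lee_pmul => //.
  by apply: prode_ge0 => j _.
rewrite -big_filter; apply: prode_le1 => j; rewrite aff_ge0; exact: aff_le1.
Qed.

Let msqrtL A k n : measurable_fun setT (fun w => sqrtL A k w n).
Proof.
by apply: measurable_obs_prod => // j; exact: measurable_sqrt_lik_ratio.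
Qed.

(** With [s] the square root of the ratio, [c * s <= (x + y * s ^+ 2) / 2] by
    the inequality between arithmetic and geometric means; the change of
    measure bounds the integral of [s ^+ 2]. The two uses differ in which of
    [x] and [y] carries the large factor. *)
Lemma integral_sqrt_flip_ratio A k n E x y c :
  filtration obs n E -> (0 <= x)%R -> (0 <= y)%R -> (0 <= c)%R ->
  (c ^+ 2 = x * y)%R ->
  \int[P A]_(w in E) (c * sqrtL A k w n)%:E <=
  2^-1%:E * (x%:E * P A E + y%:E * P (flip A k) E).
Proof.
move=> FE x0 y0 c0 cxy.
have mE := filtration_measurable obs_measurable FE.
have mL : measurable_fun setT (fun w => (flip_ratio f obs A k w n)%:E).
  apply/measurable_EFinP; apply: measurable_obs_prod => // j.
  exact: measurable_lik_ratio.
have L0 w : 0 <= (flip_ratio f obs A k w n)%:E.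
  by rewrite lee_fin -(sqr_sqrt_flip_ratio obs f0) sqr_ge0.
apply: (@le_trans _ _ (\int[P A]_(w in E)
    (2^-1%:E * (x%:E + y%:E * (flip_ratio f obs A k w n)%:E)))).
  apply: ge0_le_integral => //.
  - by move=> w _; rewrite lee_fin mulr_ge0// sqrt_flip_ratio_ge0.
  - by apply/measurable_EFinP/measurable_funTS/measurable_funM.
  - apply: emeasurable_funM => //; apply: emeasurable_funD => //.
    by apply: emeasurable_funM => //; exact: measurable_funTS.
  - move=> w _.
    rewrite [leRHS](_ : _ = (2^-1 * (x + y * flip_ratio f obs A k w n))%:E)//.
    rewrite lee_fin -(sqr_sqrt_flip_ratio obs f0) -/(sqrtL A k w n).
    set s := sqrtL A k w n.
    have s0 : (0 <= s)%R by exact: sqrt_flip_ratio_ge0.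
    have z0 : (0 <= 2^-1 * (x + y * s ^+ 2))%R.
      by rewrite mulr_ge0// addr_ge0// mulr_ge0// sqr_ge0.
    rewrite -(@ler_pXn2r _ 2)// ?nnegrE ?mulr_ge0// exprMn cxy.
    have := sqr_ge0 (x - y * s ^+ 2)%R; nra.
rewrite ge0_integralZl//; last 2 first.
- apply: emeasurable_funD => //.
  by apply: emeasurable_funM => //; exact: measurable_funTS.
- by move=> w _; apply: adde_ge0; [rewrite lee_fin|exact: mule_ge0].
rewrite lee_wpmul2l//.
rewrite ge0_integralD//; last 2 first.
- by move=> w _; rewrite mule_ge0.
- by apply: emeasurable_funM => //; exact: measurable_funTS.
rewrite integral_cst// leeD2l//.
rewrite ge0_integralZl//; last exact: measurable_funTS.
rewrite lee_wpmul2l ?lee_fin//.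
exact: (change_of_measure obs_measurable (sdens_density A)
  (sdens_density (flip A k)) (P_law A) (P_law (flip A k)) FE).
Qed.

Lemma sum_integral_sqrt_flip_ratio A k (theta : R) n E c :
  (0 <= theta < 1)%R ->
  \prod_j affinity mu (sdens A) (sdens (flip A k)) j <= theta%:E ->
  (0 <= c)%R -> filtration obs n E ->
  \sum_(j <oo) \int[P A]_(w in E) (c * sqrtL A k w (n + j))%:E <=
  ((1 - theta)^-1)%:E * \int[P A]_(w in E) (c * sqrtL A k w n)%:E.
Proof.
move=> t01 afft c0 FE; rewrite -[in leRHS](addn0 n).
have mE := filtration_measurable obs_measurable FE.
have cs0 m w : 0 <= (c * sqrtL A k w m)%:E.
  by rewrite lee_fin mulr_ge0// sqrt_flip_ratio_ge0.
apply: (@nneseries_le_geometric _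
  (fun j => \int[P A]_(w in E) (c * sqrtL A k w (n + j))%:E)) => //.
  by move=> j; apply: integral_ge0 => w _; exact: cs0.
move=> j; rewrite addnS; have FE' : filtration obs (n + j) E.
  exact: (filtration_le (leq_addr j n)).
under eq_integral do rewrite EFinM.
under [X in _ <= _ * X]eq_integral do rewrite EFinM.
have ms m : measurable_fun E (fun w => (sqrtL A k w m)%:E).
  by apply/measurable_EFinP/measurable_funTS; exact: msqrtL.
have s0 m w : E w -> 0 <= (sqrtL A k w m)%:E.
  by move=> _; rewrite lee_fin sqrt_flip_ratio_ge0.
rewrite !ge0_integralZl//.
rewrite (integral_sqrt_lik_ratio obs_measurable (sdens_density A)
  (sdens_density (flip A k)) (P_law A) FE').
rewrite muleCA lee_wpmul2r// mule_ge0// ?lee_fin// integral_ge0//.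
all: exact: s0.
Qed.

Lemma ae_stream_density_neq0 A :
  {ae P A, forall w, forall s j, sdens A j (obs s j w) != 0%R}.
Proof.
apply: ae_foralln => s.
have : {ae P A, forall w, forall m (mK : (m < K)%N),
    sdens A (Ordinal mK) (obs s (Ordinal mK) w) != 0%R}.
  apply: ae_foralln => m; have [mK|Km] := pselect (m < K)%N; last first.
    by apply: aeW => w mK; case: Km.
  pose Z := sdens A (Ordinal mK) @^-1` [set 0%R].
  have mZ : measurable Z.
    have [mf _ _] := sdens_density A (Ordinal mK).
    by rewrite -[Z]setTI; exact: mf.
  exists (obs s (Ordinal mK) @^-1` Z); split.
  - by rewrite -[_ @^-1` _]setTI; exact: obs_measurable.
  - have [PE _] := P_law A; apply/eqP; rewrite [eqbLHS]PE//; apply/eqP.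
    by apply: integral0_eq => x Zx; congr _%:E; exact: Zx.
  - move=> w /= nw; apply: contrapT => wZ; apply: nw => mK'.
    apply/eqP => w0; apply: wZ; rewrite /Z /=.
    by rewrite (bool_irrelevance mK mK').
by apply: filterS => w sw [m mK]; exact: sw.
Qed.

(** On the event that [T = n], the time that the Intersection rule still has to
    run is at most the number of pairs of a time [n + j] and a stream [k] such
    that [k] is then inside the continuation region. Each such pair is charged
    [expR (h / 2) * sqrt L], which is at least 1. *)
Lemma expected_intersection_time_le A T a b h : stopping_time obs T ->
  (a <= h)%R -> (b <= h)%R ->
  expected_time P A (intersection_time obs f a b) <=
  expected_time P A T + \sum_k \sum_(n <oo) \sum_(j <oo)
    \int[P A]_(w in stops_at T n) (expR (h / 2) * sqrtL A k w (n + j))%:E.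
Proof.
move=> T_stop ah bh.
have mT n := measurable_stops_at obs_measurable T_stop n.
have mtime : measurable_fun setT (etime T : Omega -> \bar R).
  exact: (@measurable_etime R K dX X d Omega obs obs_measurable T T_stop).
pose g k n w := (expR (h / 2) * sqrtL A k w n)%:E.
have g0 k n w : 0 <= g k n w.
  by rewrite lee_fin mulr_ge0 ?expR_ge0// sqrt_flip_ratio_ge0.
have mg k n : measurable_fun setT (g k n).
  by apply/measurable_EFinP/measurable_funM => //; exact: msqrtL.
pose F k n w : \bar R := \sum_(j <oo) g k (n + j)%N w.
have F0 k n w : 0 <= F k n w by apply: nneseries_ge0.
have mF k n : measurable_fun setT (F k n).
  by apply: ge0_emeasurable_sum.
pose FT k n w : \bar R := (\1_(stops_at T n) w)%:E * F k n w.
pose G k w : \bar R := \sum_(n <oo) FT k n w.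
have FT0 k n w : 0 <= FT k n w by rewrite mule_ge0// lee_fin.
have mFT k n : measurable_fun setT (FT k n).
  apply: emeasurable_funM => //.
  by apply/measurable_EFinP; exact: measurable_indic.
have G0 k w : 0 <= G k w by apply: nneseries_ge0.
have mG k : measurable_fun setT (G k).
  by apply: ge0_emeasurable_sum.
have etime_ge0 T' w : 0 <= @etime R d Omega T' w.
  by rewrite /etime; case: (T' w) => [n|] /=; rewrite ?lee_fin ?le0y.
apply: (@le_trans _ _ (\int[P A]_w (etime T w + \sum_k G k w))).
  apply: ge0_ae_le_integral_lower => //.
  - by move=> w; rewrite adde_ge0// sume_ge0.
  - apply: emeasurable_funD => //; exact: emeasurable_sum.
  - move: (ae_stream_density_neq0 A); apply: filterS => w Aw.
    rewrite [etime T w]/etime; case Tw : (T w) => [n|]/=; last first.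
      by rewrite addye ?leey// gt_eqF// (lt_le_trans (ltNyr 0))// sume_ge0.
    apply: (@le_trans _ _ (n%:R%:E + \sum_(j <oo) \sum_k g k (n + j)%N w)).
      apply: first_time_le => [j|j]; first exact: sume_ge0.
      have n1 : (1 <= n + j)%N.
        rewrite (leq_trans _ (leq_addr _ _))// lt0n; apply/eqP => n0.
        by have [/(_ w)] := T_stop; rewrite Tw n0 eqxx.
      rewrite n1/= negb_forall => /existsP[k /negPn lamk].
      rewrite (bigD1 k)//= -[leLHS]adde0 leeD ?sume_ge0// lee_fin.
      exact: (sqrt_flip_ratio_exit f0 Aw ah bh lamk).
    rewrite leeD2l// nneseries_sum; last by move=> *; exact: g0.
    apply: lee_sum => k _.
    apply: le_trans (nneseries_lim_ge n.+1 _); last by move=> *; exact: FT0.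
    rewrite big_nat_recr//= [in leRHS]/FT indicE mem_set// mul1e leeDr//.
    by apply: sume_ge0 => i _; exact: FT0.
rewrite ge0_integralD//; last 2 first.
- by move=> w _; apply: sume_ge0.
- exact: emeasurable_sum.
rewrite leeD2l//.
rewrite ge0_integral_sum//; apply: lee_sum => k _.
rewrite integral_nneseries//.
apply: lee_nneseries => [n _ _|n _]; first by apply: integral_ge0.
rewrite -integral_nneseries//; last 2 first.
- by move=> j; apply: measurable_funTS; exact: mg.
- by move=> j w _; exact: g0.
rewrite [leRHS]integral_mkcond le_eqVlt; apply/orP; left; apply/eqP.
apply: eq_integral => w _.
rewrite patchE /FT indicE; case: ifPn => _; first by rewrite mul1e.
by rewrite mul0e.
Qed.

(** The event that [T = n] is split according to whether the decision [A] is
    taken. In the first part [flip A k] is misidentified, in the second one [A]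
    is; in each part the factor [expR h] is made to multiply the probability of
    the error. *)
Lemma expected_intersection_time_error A (theta : 'I_K -> R) T D a b h eps :
  sequential_procedures obs (T, D) -> (a <= h)%R -> (b <= h)%R ->
  (forall k, (0 <= theta k < 1)%R) ->
  (forall k,
     \prod_j affinity mu (sdens A) (sdens (flip A k)) j <= (theta k)%:E) ->
  (forall B, P B [set w | D w <> B] <= eps%:E) ->
  expected_time P A (intersection_time obs f a b) <=
  expected_time P A T + (\sum_k (1 - theta k)^-1 * (1 + expR h * eps))%:E.
Proof.
move=> [/= T_stop D_stop] ah bh t01 afft Deps.
apply: (le_trans (expected_intersection_time_le A T_stop ah bh)).
rewrite leeD2l// -sumEFin; apply: lee_sum => k _.
have c0 : (0 <= (1 - theta k)^-1)%R.
  by rewrite invr_ge0 subr_ge0; case/andP: (t01 k) => _ /ltW.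
have mD B : measurable [set w | D w = B].
  exact: (filtration_oo_measurable obs_measurable (D_stop B).1).
pose right : set Omega := [set w | D w = A].
have mright : measurable right by exact: mD.
pose E1 n := right `&` stops_at T n.
pose E2 n := stops_at T n `\` E1 n.
have FE1 n : filtration obs n (E1 n).
  exact: (filtration_stops_atI T_stop (D_stop A).2).
have FE2 n : filtration obs n (E2 n).
  by apply: filtrationD => //; exact: filtration_stops_at.
have mE1 n : measurable (E1 n).
  exact: (filtration_measurable obs_measurable (FE1 n)).
have mE2 n : measurable (E2 n).
  exact: (filtration_measurable obs_measurable (FE2 n)).
have sumE (Q : probability Omega R) (E : nat -> set Omega) U :
    (forall n, measurable (E n)) -> measurable U ->
    (forall n, E n `<=` U `&` stops_at T n) ->
    \sum_(n <oo) Q (E n) <= Q U.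
  move=> mE mU EU; have tE : trivIset setT E.
    apply/trivIsetP => m n _ _ mn; rewrite -subset0 => w [/EU[_ wm] /EU[_ wn]].
    have [mn'] : Some m = Some n := etrans (esym wm) wn.
    by rewrite mn' eqxx in mn.
  have mUE : measurable (\bigcup_n E n) by exact: bigcupT_measurable.
  rewrite (cvg_lim _ (@measure_semi_sigma_additive _ _ _ Q E mE tE mUE))//.
  by apply: le_measure; rewrite ?inE// => w [n _ /EU[]].
pose H := expR h.
have H0 : (0 <= H)%R by exact: expR_ge0.
have cH : (expR (h / 2) ^+ 2 = H)%R.
  by rewrite -expRM_natl (_ : 2%:R * (h / 2) = h)%R// mulrC divfK.
pose bd n := 2^-1%:E * ((P A (E1 n) + H%:E * P (flip A k) (E1 n)) +
  (H%:E * P A (E2 n) + P (flip A k) (E2 n))).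
apply: (@le_trans _ _ (\sum_(n <oo) ((1 - theta k)^-1)%:E * bd n)).
  apply: lee_nneseries => [n _ _|n _].
    by apply: nneseries_ge0 => j _ _; apply: integral_ge0 => w _;
      rewrite lee_fin mulr_ge0 ?expR_ge0// sqrt_flip_ratio_ge0.
  apply: (le_trans
    (sum_integral_sqrt_flip_ratio (t01 k) (afft k) (expR_ge0 _) _)).
    exact: filtration_stops_at.
  rewrite lee_wpmul2l// /bd.
  (* [x := 1, y := H] on [E1 n], [x := H, y := 1] on [E2 n] *)
  have -> : stops_at T n = E1 n `|` E2 n.
    by rewrite setDUK// => w [].
  rewrite ge0_integral_setU//; last 3 first.
  - by apply/measurable_EFinP/measurable_funTS/measurable_funM.
  - by move=> w _; rewrite lee_fin mulr_ge0 ?expR_ge0// sqrt_flip_ratio_ge0.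
  - by apply/disj_setPS => w [wE1 [_]]; exact.
  rewrite ge0_muleDr ?adde_ge0 ?mule_ge0// ?lee_fin//.
  apply: leeD.
    have := integral_sqrt_flip_ratio A k (FE1 n) (@ler01 R) H0
      (expR_ge0 (h / 2)).
    by rewrite mul1r mul1e; apply; exact: cH.
  have := integral_sqrt_flip_ratio A k (FE2 n) H0 (@ler01 R) (expR_ge0 (h / 2)).
  by rewrite mulr1 mul1e; apply; exact: cH.
have bd0 n : 0 <= bd n.
  by rewrite mule_ge0 ?adde_ge0 ?mule_ge0 ?lee_fin.
rewrite nneseriesZl// EFinM lee_wpmul2l// nneseriesZl; last first.
  by move=> n _; rewrite ?adde_ge0 ?mule_ge0 ?lee_fin.
rewrite nneseriesD; last 2 first.
- by move=> n _ _; rewrite ?adde_ge0 ?mule_ge0 ?lee_fin.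
- by move=> n _ _; rewrite ?adde_ge0 ?mule_ge0 ?lee_fin.
rewrite !nneseriesD ?nneseriesZl//; last 2 first.
- by move=> n _ _; rewrite mule_ge0.
- by move=> n _ _; rewrite mule_ge0.
have wrongE B : P B (~` [set w | D w = B]) <= eps%:E by exact: Deps.
have kA : flip A k <> A.
  by move=> /setP/(_ k); rewrite mem_flip; case: (k \in A).
apply: (@le_trans _ _ (2^-1%:E * ((1 + H%:E * eps%:E) + (H%:E * eps%:E + 1)))).
  rewrite lee_wpmul2l//; apply: leeD; apply: leeD.
  - apply: (le_trans (sumE _ _ setT _ _ _) (probability_le1 _ _)) => // n.
    by rewrite setTI => w [].
  - rewrite lee_wpmul2l ?lee_fin//.
    apply: (le_trans (sumE _ _ right mE1 mright _)).
      by move=> n w.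
    apply: (le_trans _ (wrongE (flip A k))); apply: le_measure; rewrite ?inE//.
      by apply: measurableC; exact: mD.
    by move=> w /= -> kA'; exact: kA.
  - rewrite lee_wpmul2l ?lee_fin//.
    apply: (le_trans _ (wrongE A)); apply: sumE => //; first exact: measurableC.
    by move=> n w [wn wE]; split => // wA; apply: wE.
  - apply: (le_trans (sumE _ _ setT _ _ _) (probability_le1 _ _)) => // n.
    by rewrite setTI => w [].
rewrite [leLHS](_ : _ = (2^-1 * ((1 + H * eps) + (H * eps + 1)))%:E)//.
rewrite lee_fin le_eqVlt; apply/orP; left; apply/eqP.
by rewrite -/H; field.
Qed.

End intersection_rule_bound.

(** * Error control and thresholds *)

(** Some stream is either wrongly included or wrongly excluded, which makes the
    corresponding numerator at least 1, while both denominators are at most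
    [K]. *)
Lemma wrong_decision_proportions (R : realType) (K : nat) (A D : {set 'I_K}) :
  D <> A ->
  (1 <= K%:R *
    (@false_discovery_prop R K A D + @false_nondiscovery_prop R K A D))%R.
Proof.
move=> DA.
have prop_ge0 (m n : nat) : (0 <= m%:R / n%:R :> R)%R by rewrite divr_ge0.
have prop_ge (B E : {set 'I_K}) : (0 < #|B|)%N ->
    (1 <= K%:R * (#|B|%:R / (maxn #|E| 1)%:R) :> R)%R.
  move=> B0; have K0 : (0 < K)%N.
    by rewrite (leq_trans B0)// -[leqRHS]card_ord max_card.
  rewrite mulrA ler_pdivlMr ?ltr0n ?leq_max ?orbT// mul1r -natrM ler_nat.
  rewrite (@leq_trans K)//; last by rewrite leq_pmulr.
  by rewrite geq_max K0 andbT -[leqRHS]card_ord max_card.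
have [k kDA] : exists k, (k \in D) != (k \in A).
  apply: contrapT => DA'; apply: DA; apply/setP => k.
  by apply: contrapT => kDA; apply: DA'; exists k; exact/eqP.
rewrite mulrDr; have [kD|kD] := boolP (k \in D).
  rewrite ler_wpDr ?mulr_ge0//; apply: prop_ge; apply/card_gt0P; exists k.
  by rewrite inE kD andbT; move: kDA; rewrite kD; case: (k \in A).
rewrite ler_wpDl ?mulr_ge0//; apply: prop_ge; apply/card_gt0P; exists k.
by rewrite inE kD; move: kDA; rewrite (negbTE kD); case: (k \in A).
Qed.

Section fdr.
Context (R : realType) (K : nat) (dX : 'I_K -> measure_display)
  (X : forall k, measurableType (dX k))
  (d : measure_display) (Omega : measurableType d)
  (obs : nat -> forall k, Omega -> X k).
Hypothesis obs_measurable : forall s k, measurable_fun [set: Omega] (obs s k).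
Variable P : {set 'I_K} -> probability Omega R.

Lemma measurable_decision (D : Omega -> {set 'I_K}) (phi : {set 'I_K} -> R) :
  (forall B, measurable [set w | D w = B]) ->
  measurable_fun setT (fun w => phi (D w)).
Proof.
move=> mD; rewrite (_ : (fun w => _) =
    (fun w => \sum_B phi B * \1_[set w | D w = B] w)%R).
  apply: measurable_sum => B; apply: measurable_funM => //.
apply/funext => w; rewrite (bigD1 (D w))//= big1 ?addr0.
  by rewrite indicE mem_set// mulr1.
move=> B BD; rewrite indicE memNset ?mulr0// => DB.
by rewrite DB eqxx in BD.
Qed.

Lemma fdr_wrong_decision alpha beta delta A :
  fdr_class obs P alpha beta delta ->
  P A [set w | delta.2 w <> A] <= (K%:R * (alpha + beta))%:E.
Proof.
move=> [[_ D_stop] fdr fnr].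
have mD B : measurable [set w | delta.2 w = B].
  exact: (filtration_oo_measurable obs_measurable (D_stop B).1).
pose fd A w : R := false_discovery_prop A (delta.2 w).
pose fn A w : R := false_nondiscovery_prop A (delta.2 w).
have fd0 w : (0 <= fd A w)%R by rewrite divr_ge0.
have fn0 w : (0 <= fn A w)%R by rewrite divr_ge0.
have mfd : measurable_fun setT (fun w => (fd A w)%:E).
  by apply/measurable_EFinP; exact: measurable_decision.
have mfn : measurable_fun setT (fun w => (fn A w)%:E).
  by apply/measurable_EFinP; exact: measurable_decision.
have mW : measurable [set w | delta.2 w <> A] by exact: measurableC (mD A).
rewrite -[X in P A X]setIT -integral_indic//.
apply: (@le_trans _ _ (\int[P A]_w (K%:R%:E * ((fd A w)%:E + (fn A w)%:E)))).
  apply: ge0_le_integral => //.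
  - by apply/measurable_EFinP; exact: measurable_indic.
  - by apply: emeasurable_funM => //; exact: emeasurable_funD.
  - move=> w _; rewrite -EFinD -EFinM lee_fin indicE.
    case: (boolP (w \in _)) => [/set_mem/= wA|_].
      exact: wrong_decision_proportions.
    by rewrite mulr_ge0// addr_ge0.
rewrite ge0_integralZl//; last 2 first.
- exact: emeasurable_funD.
- by move=> w _; rewrite adde_ge0 ?lee_fin.
rewrite ge0_integralD//; last 2 first.
- by move=> w _; rewrite lee_fin.
- by move=> w _; rewrite lee_fin.
rewrite EFinM EFinD lee_wpmul2l ?lee_fin//; apply: leeD.
- apply: le_trans fdr.
  apply: le_trans (le_bigmax -oo (fun A => 'E_(P A)[fd A]) A).
  by rewrite unlock.
- apply: le_trans fnr.
  apply: le_trans (le_bigmax -oo (fun A => 'E_(P A)[fn A]) A).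
  by rewrite unlock.
Qed.

(** Comparing the Intersection rule with the procedure that decides after one
    observation shows that its expected time is finite. *)
Lemma constant_procedure A :
  sequential_procedures obs (fun=> Some 1%N, fun=> A).
Proof.
have time1 t : (1 <= t)%N -> time_le (fun _ : Omega => Some 1%N) t = setT.
  by move=> t1; apply/seteqP; split.
have sT (G : set (set Omega)) : <<s G >> setT.
  exact: (@measurableT _ (g_sigma_algebraType G)).
have s0 (G : set (set Omega)) : <<s G >> set0.
  exact: (@measurable0 _ (g_sigma_algebraType G)).
split => [|B] /=.
  by split => // t /time1 ->; exact: sT.
rewrite (_ : [set _ | A = B] = if A == B then setT else set0); last first.
  by case: eqP => AB; apply/seteqP; split.
case: ifP => _; split; do ?[exact: sT|exact: s0] => t t1.
  by rewrite setTI time1//; exact: sT.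
by rewrite set0I; exact: s0.
Qed.

End fdr.

(** Finiteness of [x] matters: the dual difference of two infinite values is
    infinite. *)
Lemma excess_le (R : realType) (x i : \bar R) (M : R) :
  0 <= x < +oo -> x - M%:E <= i -> (x - i)%dE <= M%:E.
Proof.
case: x => [r _| |]; last by []; last by rewrite ltxx andbF.
case: i => [s| |]//= rs; last by rewrite /dual_adde/= leNye.
by rewrite lee_fin; rewrite lee_fin in rs; lra.
Qed.

Section thresholds.
Context (R : realType).

Lemma expR_threshold (K : nat) (x : R) : (0 < K)%N -> (0 < x < 1)%R ->
  expR (`|ln x| + ln K%:R) = (K%:R / x)%R.
Proof.
move=> K0 /andP[x0 x1].
rewrite ler0_norm; last by rewrite ln_le0// ltW.
rewrite expRD expRN !lnK ?posrE ?ltr0n//; exact: mulrC.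
Qed.

(** [expR h] is [K / z] with [z] one of [x] and [y], and [x + y] is at most
    [(1 + C) * z] for either choice since [x] and [y] are comparable. *)
Lemma expR_max_threshold (K : nat) (C x y : R) : (0 < K)%N ->
  (0 < x < 1)%R -> (0 < y < 1)%R -> (0 < C)%R -> (C^-1 * x <= y <= C * x)%R ->
  (expR (Num.max (`|ln y| + ln K%:R) (`|ln x| + ln K%:R)) * (K%:R * (x + y))
   <= K%:R ^+ 2 * (1 + C))%R.
Proof.
move=> K0 x01 y01 C0 /andP[xy yx].
have [x0 x1] := andP x01; have [y0 y1] := andP y01.
have xCy : (x <= C * y)%R by rewrite -ler_pdivrMl.
have key z : (0 < z)%R -> (x + y <= (1 + C) * z)%R ->
    (K%:R / z * (K%:R * (x + y)) <= K%:R ^+ 2 * (1 + C))%R.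
  move=> z0 xyz; rewrite mulrACA -expr2 ler_pM2l ?exprn_gt0 ?ltr0n//.
  by rewrite mulrC ler_pdivrMr.
rewrite maxEle; case: ifP => _; rewrite expR_threshold//.
  by apply: key => //; lra.
by apply: key => //; lra.
Qed.

End thresholds.

Theorem theorem7 (R : realType) (K : nat) (K_ge2 : (2 <= K)%N)
  (dX : 'I_K -> measure_display) (X : forall k, measurableType (dX k))
  (mu : forall k, {sigma_finite_measure set X k -> \bar R})
  (f : forall k, bool -> X k -> R)
  (f_density : forall k i, is_density (mu k) (f k i))
  (d : measure_display) (Omega : measurableType d)
  (obs : nat -> forall k, Omega -> X k)
  (obs_measurable : forall s k, measurable_fun [set: Omega] (obs s k))
  (P : {set 'I_K} -> probability Omega R)
  (P_law : forall A : {set 'I_K},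
     is_law obs mu (fun k => f k (k \in A)) (P A))
  (log_ratio_mean : forall k i,
     0 < \int[mu k]_x (log_ratio (f k i) (f k (~~ i)) x * (f k i x)%:E))
  (log_ratio_second_moment : forall k i,
     \int[mu k]_x ((log_ratio (f k i) (f k (~~ i)) x) ^+ 2 * (f k i x)%:E)
       < +oo)
  (C : R) (C_gt0 : (0 < C)%R) (A : {set 'I_K}) :
  let a (beta : R) : R := (`|ln beta| + ln K%:R)%R in
  let b (alpha : R) : R := (`|ln alpha| + ln K%:R)%R in
  limf_esup
    (fun p : R * R =>
       excess_time P A (intersection_rule obs f (a p.2) (b p.1))
         (fdr_class obs P p.1 p.2))
    (within [set p : R * R | [/\ (0 < p.1 < 1)%R, (0 < p.2 < 1)%R
                               & (C^-1 * p.1 <= p.2 <= C * p.1)%R]]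
            (nbhs ((0, 0)%R : R * R)))
  < +oo.
Proof.
cbv zeta.
pose a (beta : R) : R := (`|ln beta| + ln K%:R)%R.
pose b (alpha : R) : R := (`|ln alpha| + ln K%:R)%R.
have K0 : (0 < K)%N by exact: leq_trans K_ge2.
pose theta k := sval (cid2 (flip_affinity f_density log_ratio_mean A k)).
have theta01 k : (0 <= theta k < 1)%R.
  by rewrite /theta; case: cid2.
have affinity_theta k : \prod_j affinity (fun k => mu k) (stream_density f A)
    (stream_density f (flip A k)) j <= (theta k)%:E.
  by rewrite /theta; case: cid2.
pose M : R := (\sum_k (1 - theta k)^-1 * (1 + K%:R ^+ 2 * (1 + C)))%R.
rewrite limf_esupE.
set S := [set p : R * R | _].
apply: (@le_lt_trans _ _ M%:E); last by rewrite ltry.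
apply: (@le_trans _ _ (ereal_sup [set excess_time P A
    (intersection_rule obs f (a p.2) (b p.1))
    (fdr_class obs P p.1 p.2) | p in S])).
  (* the bound is uniform over the constraint set, so that no smaller
     neighborhood of the origin is needed *)
  apply: ereal_inf_lbound; exists S => //.
  exact: nearW.
apply: ge_ereal_sup => _ [[alpha beta] [/= alpha01 beta01 alphabeta] <-].
pose h := Num.max (a beta) (b alpha).
have ah : (a beta <= h)%R by rewrite le_max lexx.
have bh : (b alpha <= h)%R by rewrite le_max lexx orbT.
have bound T D eps : sequential_procedures obs (T, D) ->
    (forall B, P B [set w | D w <> B] <= eps%:E) ->
    expected_time P A (intersection_time obs f (a beta) (b alpha)) <=
    expected_time P A T + (\sum_k (1 - theta k)^-1 * (1 + expR h * eps))%:E.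
  move=> TD Deps.
  exact: (expected_intersection_time_error f_density obs_measurable P_law
    TD ah bh theta01 affinity_theta Deps).
rewrite /excess_time /=; apply: excess_le.
  rewrite integral_ge0 => [|w _]; last first.
    rewrite /etime; case: intersection_time => [n|] /=.
      by rewrite lee_fin.
    exact: le0y.
  apply: (le_lt_trans (bound _ _ 1%R (constant_procedure obs A) _)).
    move=> B; apply: probability_le1.
    have [AB|AB] := pselect (A <> B).
      by rewrite (_ : [set _ | _] = setT)//; apply/seteqP; split.
    by rewrite (_ : [set _ | _] = set0)//; apply/seteqP; split.
  rewrite /expected_time /etime /= integral_cst// mul1e.
  apply: lte_add_pinfty; last exact: ltry.
  by apply: (le_lt_trans (probability_le1 (P A) measurableT)); exact: ltry.
apply: le_ereal_inf_tmp => _ [[T D] TD <-].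
have [seqTD _ _] := TD.
rewrite leeBlDr//.
apply: (le_trans (bound T D _ seqTD
  (fun B => fdr_wrong_decision obs_measurable B TD))).
rewrite leeD2l// lee_fin; apply: ler_sum => k _.
rewrite ler_wpM2l ?invr_ge0 ?subr_ge0//.
  by case/andP: (theta01 k) => _ /ltW.
rewrite lerD2l; exact: expR_max_threshold.
Qed.
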